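(* For every prime power $q=8n+1>9$ there exists a $(\mathbb Z_2\times\mathbb F_q,\{2^{4n+1},4^{2n}\},2)$-PDF which is the base (starter) parallel class of an HS$(2,\{2,4\},2q)$.
   Context: For a subset $B$ of an additive group, $\Delta B$ is the multiset of differences $b-b'$ over ordered pairs of distinct elements of $B$. A $(\Gamma,K,\lambda)$-PDF is a collection of subsets of $\Gamma$ partitioning $\Gamma$, with multiset of sizes $K$ (written in exponential notation: $\{k_1^{\mu_1},\dots\}$ means $k_i$ with multiplicity $\mu_i$), such that the multiset union of the $\Delta B$ equals $\lambda$ copies of $\Gamma\setminus\{0\}$. A linear space S$(2,K,v)$: $v$ points, blocks with sizes in $K$ (each element of $K$ occurring), every pair of points in exactly one block; a resolution partitions the blocks into parallel classes each partitioning the points. A PDF $\mathcal P$ in $\Gamma$ with $|\Gamma|=v$ is the base parallel class of an HS$(2,K,v)$ if $\{\mathcal P+x\mid x\in\Gamma\}$ is the set of parallel classes of a resolved S$(2,K,v)$ with point set $\Gamma$ (so the translations act sharply transitively on points and transitively on parallel classes). *)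

(* Defs.v *)
From HB Require Import structures.
From mathcomp Require Import all_boot all_order all_fingroup all_algebra.

Set Implicit Arguments.
Unset Strict Implicit.
Unset Printing Implicit Defensive.

Import GRing.Theory.
Local Open Scope ring_scope.

(* The library has both the finType and the zmodType structures on products,
   but not their join. *)
HB.instance Definition _ (U V : finZmodType) := GRing.Zmodule.on (U * V)%type.

(* Finite multisets are sequences compared with [perm_eq]; in particular the
   multiset of sizes written {k^mu, l^nu} is [nseq mu k ++ nseq nu l]. *)

Definition Delta (G : finZmodType) (B : {set G}) : seq G :=
  [seq u.1 - u.2 | u <- enum (setX B B) & u.1 != u.2].

Definition is_PDF (G : finZmodType) (K : seq nat) (lambda : nat)
    (P : {set {set G}}) : Prop :=
  [/\ partition P [set: G],
      perm_eq [seq #|B| | B : {set G} <- enum P] K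
    & perm_eq (flatten [seq Delta B | B : {set G} <- enum P])
              (flatten (nseq lambda (enum [set~ (0 : G)])))].

(* S(2,K,v) on the point set T.  Blocks form a set rather than a multiset; as
   long as K has no element smaller than 2 this is no restriction, since a
   block is then determined by any two of its points. *)
Definition is_linear_space (T : finType) (K : {pred nat}) (v : nat)
    (blocks : {set {set T}}) : Prop :=
  [/\ #|T| = v,
      forall B : {set T}, B \in blocks -> #|B| \in K,
      forall k : nat, k \in K -> exists2 B : {set T}, B \in blocks & #|B| = k
    & forall x y : T, x != y ->
        exists! B : {set T}, [/\ B \in blocks, x \in B & y \in B]].

Definition is_resolution (T : finType) (blocks : {set {set T}})
    (R : {set {set {set T}}}) : Prop :=
  partition R blocks /\
  forall C : {set {set T}}, C \in R -> partition C [set: T].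

Definition translate_block (G : finZmodType) (B : {set G}) (x : G) : {set G} :=
  [set b + x | b in B].

Definition translate_class (G : finZmodType) (P : {set {set G}}) (x : G) :
    {set {set G}} :=
  [set translate_block B x | B : {set G} in P].

(* The translates form a set, so P + x and P + y count once when equal. *)
Definition is_base_parallel_class (G : finZmodType) (K : {pred nat}) (v : nat)
    (P : {set {set G}}) : Prop :=
  exists blocks : {set {set G}},
    is_linear_space K v blocks /\
    is_resolution blocks [set translate_class P x | x : G].

(* Main.v *)
Require Import Defs.
From HB Require Import structures.
From mathcomp Require Import all_boot all_order all_fingroup all_algebra all_field.
From Stdlib Require Import NArith Nnat.
From mathcomp Require Import zify ring.

(* The translations acting on the starter class have stabilizer {0, (1, 0)}, so
   up to adding (1, 0) one needs n quadruples and 2n pairs whose projections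
   partition F* and whose differences cover each (e, x), x <> 0, once.  Let
   chi x = x^(2n) be the quartic residue class and S a set of n representatives
   of the fourth powers modulo {1, -1}.  Take b1, ..., b4 of distinct classes,
   the quadruple {b1, b2, b3, b4} with only b4 on level 1, and the pairs
   {-b1, -b2} and {-b3, -b4}, and multiply them by S.  The elements automatically
   cover F*, and the differences cover everything as soon as the classes of
   b1 - b3, b2 - b3, b1 - b2, b3 - b4 are distinct, and likewise with b3
   replaced by b4 in the first two.  By cardinality, covering is enough.

   For n >= 3200 such b's exist by a second moment count: for a set A, the sum
   over x and over the classes r of (4 #{y in A : chi (x - y) = r} - #A)^2 is
   O(n #A), so the classes of the differences with A are nearly equidistributed
   around most points.  For 2 < n < 3200 they come from a table.  For q = 17
   there are none, and a variant with other pairs is used. *)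

Set Implicit Arguments.
Unset Strict Implicit.
Unset Printing Implicit Defensive.
Import Order.TTheory GRing.Theory Num.Theory.

(** * Starter classes from tight covering families *)

(** This is what lets covering suffice: lower bounds on all multiplicities together with an upper
    bound on the total length leave no room for excess. *)
Lemma perm_eq_count_size (T : eqType) (s t : seq T) :
  (forall x, count_mem x t <= count_mem x s) -> size s <= size t -> perm_eq s t.
Proof.
move=> /count_subseqP[u us tu] ss; rewrite perm_sym (perm_trans tu) //.
suff /eqP->: u == s by [].
by rewrite -(size_subseq_leqif us) eqn_leq size_subseq //= -(perm_size tu).
Qed.

(** An element common to two of the sets would occur twice in [flatten Ls]. Nonemptiness makes a
    repeated set visible in this way too. *)
Lemma uniq_flatten_sets (T : finType) (Ls : seq (seq T))
    (L := [seq [set x in l] | l <- Ls]) :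
    all (fun l => 0 < size l) Ls -> uniq (flatten Ls) ->
  [/\ uniq L, forall B C x, B \in L -> C \in L -> x \in B -> x \in C -> B = C
    & [seq #|B| | B : {set T} <- L] = [seq size l | l <- Ls] ].
Proof.
have memL Ks x (B : {set T}) : B \in [seq [set y in l] | l <- Ks] -> x \in B ->
    x \in flatten Ks.
  by case/mapP=> l lK ->; rewrite inE => xl; apply/flattenP; exists l.
rewrite /L; elim: Ls {L} => //= l Ls IHL /andP[l_gt0 /IHL{}IHL].
rewrite cat_uniq => /and3P[ul /hasPn disj /IHL[uL triv cardL]].
have l'P x B : x \in l -> B \in [seq [set y in l] | l <- Ls] -> x \notin B.
  by move=> xl BL; apply: contraL xl => /(memL _ _ _ BL)/disj.
split; last by rewrite cardL cardsE (card_uniqP ul).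
  rewrite uL andbT; apply/negP => lL.
  case: (l) l_gt0 lL l'P => // x l1 _ lL /(_ x _ _ lL).
  by rewrite !inE eqxx => /(_ isT).
move=> B C x; rewrite !inE => /predU1P[->|BL] /predU1P[->|CL] //.
- by rewrite inE => xl /(negP (l'P _ _ xl CL)).
- by rewrite inE => xB xl; case/negP: (l'P _ _ xl BL).
- exact: triv.
Qed.

(** The flattened list meets every point and is no longer than [enum T], so it is a permutation of
    [enum T] and nothing is covered twice. *)
Lemma tight_cover (T : finType) (Ls : seq (seq T)) (L := [seq [set x in l] | l <- Ls]) :
    all (fun l => 0 < size l) Ls -> sumn [seq size l | l <- Ls] <= #|T| ->
    (forall x, exists2 l, l \in Ls & x \in l) ->
  [/\ partition [set B in L] [set: T], perm_eq (enum [set B in L]) L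
    & [seq #|B| | B : {set T} <- L] = [seq size l | l <- Ls] ].
Proof.
move=> pos le_sum cov.
have uF : uniq (flatten Ls).
  rewrite (perm_uniq (_ : perm_eq (flatten Ls) (enum T))) ?enum_uniq //.
  rewrite perm_eq_count_size // ?size_flatten -?cardE // => x.
  rewrite count_uniq_mem ?enum_uniq // mem_enum inE.
  have [l lL xl] := cov x; rewrite -has_count has_pred1; apply/flattenP; by exists l.
have [uL triv cardL] := uniq_flatten_sets pos uF; split=> //.
  apply/and3P; split.
  - rewrite eqEsubset subsetT; apply/subsetP=> x _.
    have [l lL xl] := cov x; apply/bigcupP; exists [set y in l]; rewrite !inE //.
    exact: map_f.
  - apply/trivIsetP=> B C; rewrite !inE => BL CL /eqP BC.
    by apply/pred0P=> x /=; apply/andP=> -[xB xC]; apply/BC/(triv _ _ x).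
  - rewrite inE; apply/mapP=> -[l lL]; have := allP pos _ lL.
    by case: l {lL} => // x l _ /setP/(_ x); rewrite !inE eqxx.
by apply: uniq_perm => // [|B]; rewrite ?enum_uniq // mem_enum inE.
Qed.

(** * Difference counts and translation of blocks *)

(** The block is recorded along with the pair, so that the cardinality counts multiplicities over
    all blocks and a translation preserving [P] acts on the representations of [d]. *)
Definition reps (G : finZmodType) (P : {set {set G}}) (d : G) :
    {set {set G} * (G * G)} :=
  [set t | [&& t.1 \in P, t.2.1 \in t.1, t.2.2 \in t.1 & t.2.1 - t.2.2 == d]%R].

Lemma count_Delta (G : finZmodType) (P : {set {set G}}) (d : G) : d != 0%R ->
  count_mem d (flatten [seq Delta B | B : {set G} <- enum P]) = #|reps P d|.
Proof.
move=> d0; rewrite count_flatten -map_comp sumnE big_map big_enum /=.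
rewrite -sum1_card (partition_big fst (mem P)) /=; last by move=> t; rewrite inE; case/and4P.
apply: eq_bigr => B BP; rewrite /Delta count_map count_filter -size_filter.
rewrite -(card_uniqP (filter_uniq _ (enum_uniq _))) -sum1_card.
rewrite (reindex_onto (fun u => (B, u)) snd) /=; last first.
  by case=> C u /andP[_ /eqP/= ->].
apply: eq_bigl => -[a b]; rewrite mem_filter mem_enum !inE /= BP !eqxx !andbT /=.
case: (eqVneq (a - b)%R d) => [eqd|_]; rewrite ?andbF //= andbT.
by rewrite -subr_eq0 eqd d0.
Qed.

Lemma size_Delta (G : finZmodType) (B : {set G}) : size (Delta B) = #|B| * #|B|.-1.
Proof.
rewrite size_map -(card_uniqP (filter_uniq _ (enum_uniq _))).
have eqS : [seq u <- enum (setX B B) | u.1 != u.2] =i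
    setX B B :\: [set (b, b) | b in B].
  move=> [a b]; rewrite mem_filter mem_enum !inE /=.
  case: eqP => [->|ab] /=; last first.
    rewrite andbC; case: imsetP => [[c _ [ac bc]]|] //=.
    by rewrite ac bc in ab.
  case: (boolP (b \in B)) => bB; rewrite ?andbF //.
  by rewrite (imset_f (fun c => (c, c)) bB).
rewrite (eq_card eqS) cardsD (setIidPr _) ?cardsX ?card_imset; last 2 first.
- by move=> a b [].
- by apply/subsetP=> _ /imsetP[b bB ->]; rewrite !inE bB.
by rewrite -subn1 mulnBr muln1.
Qed.

Lemma mem_translate (G : finZmodType) (B : {set G}) (x y : G) :
  (y \in translate_block B x) = (y - x \in B)%R.
Proof.
apply/imsetP/idP => [[b bB ->]|yxB]; first by rewrite addrK.
by exists (y - x)%R; rewrite ?subrK.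
Qed.

Lemma card_translate (G : finZmodType) (B : {set G}) (x : G) :
  #|translate_block B x| = #|B|.
Proof. by rewrite card_imset //; apply: addIr. Qed.

Lemma translate_translate (G : finZmodType) (B : {set G}) (x y : G) :
  translate_block (translate_block B x) y = translate_block B (x + y)%R.
Proof. by apply/setP=> z; rewrite !mem_translate opprD addrA addrAC. Qed.

Definition shift_rep (G : finZmodType) (j : G) (t : {set G} * (G * G)) :=
  (translate_block t.1 j, (t.2.1 + j, t.2.2 + j)%R).

Lemma shift_rep_reps (G : finZmodType) (j : G) (P : {set {set G}}) (d : G) t :
  (forall B, B \in P -> translate_block B j \in P) ->
  t \in reps P d -> shift_rep j t \in reps P d.
Proof.
move=> Pj; rewrite !inE /= => /and4P[tP t1 t2 /eqP<-].
by rewrite Pj // !mem_translate !addrK t1 t2 opprD addrACA subrr addr0 eqxx.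
Qed.

Lemma shift_rep_neq (G : finZmodType) (j : G) t : j != 0%R -> shift_rep j t != t.
Proof.
case: t => B [a b]; apply: contraNneq => -[_ aj _].
by rewrite -(addrK a j) [(j + a)%R]addrC aj subrr.
Qed.

(** Translation by [j] moves every representation of [d] to a different one, so one representation
    yields two. The bound on the sum of the [k * k.-1] then excludes a third. *)
Lemma family_PDF (G : finZmodType) (j : G) (Ls : seq (seq G))
    (P := [set B in [seq [set x in l] | l <- Ls]]) (K := [seq size l | l <- Ls]) :
    j != 0%R -> all (fun l => 0 < size l) Ls -> sumn K <= #|G| ->
    sumn [seq k * k.-1 | k <- K] <= 2 * #|G|.-1 ->
    (forall x, exists2 l, l \in Ls & x \in l) ->
    (forall B, B \in P -> translate_block B j \in P) ->
    (forall d : G, d != 0%R -> exists l a b, [/\ l \in Ls, a \in l, b \in l & a - b = d]%R) ->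
  is_PDF K 2 P.
Proof.
move=> j0 pos leK leD cov Pj diff.
have [partP enumP cardP] := tight_cover pos leK cov.
have eqK : perm_eq [seq #|B| | B : {set G} <- enum P] K.
  by rewrite /K -cardP; apply: perm_map.
split=> //; apply: perm_eq_count_size => [d|].
  rewrite /= cats0 count_cat count_uniq_mem ?enum_uniq // mem_enum !inE.
  have [-> //|d0] := eqVneq d 0%R; rewrite count_Delta //.
  have [l [a [b [lL al bl abd]]]] := diff d d0.
  pose t := ([set x in l], (a, b)).
  have tP : t \in reps P d by rewrite !inE /= al bl abd eqxx map_f.
  have tjP := shift_rep_reps Pj tP.
  have card2 : #|[set t; shift_rep j t]| = 2 by rewrite cards2 eq_sym shift_rep_neq.
  apply: (@leq_trans 2) => //; rewrite -card2; apply: subset_leq_card.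
  by apply/subsetP=> u /set2P[]->.
rewrite /= cats0 size_cat -!cardE cardsC1 addnn -mul2n (leq_trans _ leD) //.
rewrite -(perm_sumn (perm_map _ eqK)) size_flatten /shape -!map_comp.
by apply: eq_leq; congr sumn; apply: eq_map => B /=; rewrite size_Delta.
Qed.

(** Each nonzero [d] has exactly two representations, and they differ by the translation by [j].
    Hence two points determine their block up to rewriting [B + (j + x)] as a translate of [B + j],
    and the classes [P + x] and [P + (j + x)] are equal. *)
Lemma PDF_base_class (G : finZmodType) (j : G) (P : {set {set G}}) (K : seq nat)
    (Kp : pred nat) :
    j != 0%R -> is_PDF K 2 P -> (forall B, B \in P -> translate_block B j \in P) ->
    (forall k, k \in K -> 1 < k) -> Kp =i K ->
  is_base_parallel_class Kp #|G| P.
Proof.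
move=> j0 [partP sizeP deltaP] Pj K_gt1 KpK.
have cardP B : B \in P -> #|B| \in K.
  by move=> BP; rewrite -(perm_mem sizeP); apply/mapP; exists B; rewrite ?mem_enum.
have reps2 d : d != 0%R -> #|reps P d| = 2.
  move=> d0; rewrite -count_Delta // (seq.permP deltaP) /= cats0 count_cat.
  by rewrite count_uniq_mem ?enum_uniq // mem_enum !inE d0.
have repsE d t u : d != 0%R -> t \in reps P d -> u \in reps P d ->
    u = t \/ u = shift_rep j t.
  move=> d0 td ud.
  suff /set2P : u \in [set t; shift_rep j t] by [].
  rewrite (_ : [set t; shift_rep j t] = reps P d) //.
  apply/eqP; rewrite eqEcard reps2 // cards2 eq_sym shift_rep_neq // andbT.
  by apply/subsetP=> v /set2P[]-> //; apply: shift_rep_reps.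
(* The form in which this is used: equal differences inside [B] and [B'] come from the same pair or
   from its translate by [j]. *)
have repP B B' a b a' b' : B \in P -> B' \in P -> a \in B -> b \in B ->
    a' \in B' -> b' \in B' -> a != b -> (a - b = a' - b')%R ->
    B' = B /\ a' = a \/ B' = translate_block B j /\ a' = (a + j)%R.
  move=> BP B'P aB bB aB' bB' ab dE.
  have d0 : (a - b != 0)%R by rewrite subr_eq0.
  have := repsE _ (B, (a, b)) (B', (a', b')) d0.
  by rewrite !inE /= BP B'P aB bB aB' bB' dE eqxx => -[]// [-> -> _]; [left|right].
have [/eqP covP /trivIsetP trivP P0] := and3P partP.
pose blocks := \bigcup_(x : G) translate_class P x.
have blocksP C : reflect (exists B x, B \in P /\ C = translate_block B x) (C \in blocks).
  apply: (iffP bigcupP) => [[x _ /imsetP[B BP ->]]|[B [x [BP ->]]]]; first by exists B, x.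
  by exists x => //; apply: imset_f.
have classP x : partition (translate_class P x) [set: G].
  apply/and3P; split.
  - rewrite eqEsubset subsetT; apply/subsetP=> y _.
    have : (y - x \in cover P)%R by rewrite covP inE.
    case/bigcupP=> B BP yB; apply/bigcupP; exists (translate_block B x).
      exact: imset_f.
    by rewrite mem_translate.
  - apply/trivIsetP=> _ _ /imsetP[B BP ->] /imsetP[C CP ->] BC.
    have {}BC : B != C by apply: contraNneq BC => ->.
    have /pred0P B0 := trivP _ _ BP CP BC.
    by apply/pred0P=> y /=; rewrite !mem_translate; apply: B0.
  - apply/imsetP=> -[B BP /esym/eqP]; rewrite -cards_eq0 card_translate cards_eq0.
    by move/eqP=> B0; rewrite B0 (negPf P0) in BP.
have translate_inj x : injective (fun B : {set G} => translate_block B x).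
  apply: (can_inj (g := fun B => translate_block B (- x)%R)) => B.
  by rewrite translate_translate subrr; apply/setP=> y; rewrite mem_translate subr0.
have card_class x : #|translate_class P x| = #|P| by apply: card_imset.
have class_j x : translate_class P (j + x)%R = translate_class P x.
  apply/eqP; rewrite eqEcard !card_class leqnn andbT.
  apply/subsetP=> _ /imsetP[B BP ->]; rewrite -translate_translate.
  by apply: imset_f; apply: Pj.
exists blocks; split; split=> //.
- by move=> _ /blocksP[B [x [BP ->]]]; rewrite card_translate KpK cardP.
- move=> k; rewrite KpK -(perm_mem sizeP) => /mapP[B]; rewrite mem_enum => BP ->.
  by exists (translate_block B 0%R); [apply/blocksP; exists B, 0%R|rewrite card_translate].
(* A pair [a], [b] of some [B] with [a - b = x - y] is moved onto [x], [y] by the translation by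
   [x - a]. Uniqueness is [repP]. *)
- move=> x y xy; have : 0 < #|reps P (x - y)%R| by rewrite reps2 // subr_eq0.
  case/card_gt0P=> -[B [a b]]; rewrite !inE /= => /and4P[BP aB bB /eqP abxy].
  have ab : a != b by rewrite -subr_eq0 abxy subr_eq0.
  have ybE : (y - (x - a) = b)%R by rewrite -[b](subKr a) abxy !opprB addrCA.
  exists (translate_block B (x - a)%R); split.
    by split; [apply/blocksP; exists B, (x - a)%R|rewrite mem_translate subKr|
      rewrite mem_translate ybE].
  move=> _ [/blocksP[B' [z [BP' ->]]]]; rewrite !mem_translate => xB yB.
  have abE : (a - b = (x - z) - (y - z))%R by rewrite abxy opprB addrA subrK.
  case: (repP _ _ _ _ _ _ BP BP' aB bB xB yB ab abE) => -[-> xzE].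
    by congr translate_block; rewrite -xzE subKr.
  rewrite translate_translate; congr translate_block.
  by rewrite -[x](subrK z) xzE addrC -!addrA addKr.
(* If [P + x] and [P + y] share a block, two points of that block and [repP] give [x = y] or
   [x = j + y], and in both cases the classes coincide. *)
- apply/and3P; split; first by rewrite cover_imset.
    apply/trivIsetP=> _ _ /imsetP[x _ ->] /imsetP[y _ ->]; apply: contraNT.
    case/pred0Pn=> _ /andP[/= /imsetP[B BP ->] /imsetP[B' BP' BE]].
    have [a [b [aB bB ab]]] := card_gt1P (K_gt1 _ (cardP _ BP)).
    have mem' c : c \in B -> (c + x - y \in B')%R.
      by move=> cB; rewrite -mem_translate -BE mem_translate addrK.
    have abE : (a - b = (a + x - y) - (b + x - y))%R.
      by rewrite -!(addrA _ x) opprD addrACA subrr addr0.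
    case: (repP _ _ _ _ _ _ BP BP' aB bB (mem' _ aB) (mem' _ bB) ab abE) => -[_ xyE].
      have -> // : x = y.
      by apply/eqP; rewrite -subr_eq0 -(inj_eq (addrI a)) addrA xyE addr0.
    have -> : x = (j + y)%R; last by rewrite class_j.
    by apply/eqP; rewrite -subr_eq -(inj_eq (addrI a)) addrA xyE.
  apply/imsetP=> -[x _ /esym/eqP]; rewrite -cards_eq0 card_class cards_eq0 => /eqP P_0.
  by have := in_setT (0%R : G); rewrite -covP P_0 /cover big_set0 inE.
- by move=> _ /imsetP[x _ ->].
Qed.

(** * Families of multiples of three base blocks *)

Definition scaled_block (F : finFieldType) (D : seq ('Z_2 * F)) (se : F * 'Z_2) :
    seq ('Z_2 * F) :=
  [seq (c.1 + se.2, se.1 * c.2)%R | c <- D].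

(** Both levels are taken for each multiplier, which makes the family invariant under translation by
    [(1, 0)]. *)
Definition scaled_blocks (F : finFieldType) (S : seq F) (D : seq ('Z_2 * F)) :
    seq (seq ('Z_2 * F)) :=
  [seq scaled_block D se | se <- [seq (s, e) | s <- S, e <- [:: 0; 1]%R]].

Lemma Z2P (e : 'Z_2) : e \in [:: 0; 1]%R.
Proof. by case: e => -[|[|//]] e_lt; rewrite !inE -!val_eqE. Qed.

Lemma mem_scaled_blocks (F : finFieldType) (S : seq F) (D : seq ('Z_2 * F)) s e :
  s \in S -> scaled_block D (s, e) \in scaled_blocks S D.
Proof. by move=> sS; apply/map_f/allpairsP; exists (s, e); rewrite Z2P. Qed.

Lemma scaled_blocksP (F : finFieldType) (S : seq F) (D : seq ('Z_2 * F)) l :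
  l \in scaled_blocks S D -> exists s e, s \in S /\ l = scaled_block D (s, e).
Proof.
rewrite /scaled_blocks => /mapP[_ /allpairsP[[s e] /= [sS _ ->]] ->].
by exists s, e.
Qed.

Lemma size_scaled_blocks (F : finFieldType) (S : seq F) (D : seq ('Z_2 * F)) :
  [seq size l | l <- scaled_blocks S D] = nseq (2 * size S) (size D).
Proof.
have /all_pred1P-> : all (pred1 (size D)) [seq size l | l <- scaled_blocks S D].
  by apply/allP=> _ /mapP[_ /mapP[se _ ->] ->]; rewrite /= size_map.
by rewrite !size_map size_allpairs mulnC.
Qed.

Lemma translate_scaled_block (F : finFieldType) (D : seq ('Z_2 * F)) s e :
  translate_block [set c in scaled_block D (s, e)] (1, 0)%R =
  [set c in scaled_block D (s, e + 1)%R].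
Proof.
apply/setP=> c; rewrite mem_translate !inE.
apply/mapP/mapP => -[b bD cE]; exists b => //.
  by rewrite -[c](subrK (1, 0)%R) cE; congr pair; rewrite /= ?addr0 ?addrA.
by rewrite cE; congr pair; rewrite /= ?subr0 // addrA addrK.
Qed.

(** This is [family_PDF] with [j = (1, 0)]. The multiples of [B], [D1] and [D2] are joined by the
    pair [Z], which accounts for everything with field coordinate 0. Both bounds are attained: the
    sizes add up to [2 * (4 * n + 1) + 4 * (2 * n) = 2 * q], and the numbers of differences to [2 *
    (4 * n + 1) + 12 * (2 * n) = 2 * (2 * q - 1)], where [q = 8 * n + 1]. *)
Lemma scaled_family (F : finFieldType) (n : nat) (S : seq F)
    (B D1 D2 : seq ('Z_2 * F)) :
    0 < n -> #|F| = 8 * n + 1 -> size S = n ->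
    size B = 4 -> size D1 = 2 -> size D2 = 2 ->
    (forall x : F, x != 0%R -> exists s c,
       [/\ s \in S, c \in B ++ D1 ++ D2 & x = s * c.2]%R) ->
    (forall (x : F) (e : 'Z_2), x != 0%R -> exists s D a b,
       [/\ s \in S, D \in [:: B; D1; D2], (a \in D) && (b \in D), a.1 - b.1 = e
         & x = s * (a.2 - b.2)]%R) ->
  exists P : {set {set ('Z_2 * F)%type}},
    is_PDF (nseq (4 * n + 1) 2 ++ nseq (2 * n) 4) 2 P /\
    is_base_parallel_class (pred2 2 4) (2 * #|F|) P.
Proof.
move=> n0 cardF sizeS sizeB sizeD1 sizeD2 cov diff.
pose Z : seq ('Z_2 * F) := [:: (0, 0); (1, 0)]%R.
pose Ls := Z :: scaled_blocks S D1 ++ scaled_blocks S D2 ++ scaled_blocks S B.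
have sizeLs : [seq size l | l <- Ls] = nseq (4 * n + 1) 2 ++ nseq (2 * n) 4.
  rewrite /Ls map_cons !map_cat !size_scaled_blocks sizeS sizeB sizeD1 sizeD2.
  by rewrite catA -nseqD -mulnDl -/(nseq 1 2) -[_ :: _]/(nseq 1 2 ++ _) catA -nseqD addnC.
have cardG : #|{: 'Z_2 * F}| = 2 * #|F| by rewrite card_prod card_ord.
have mem_Ls D s e : s \in S -> D \in [:: B; D1; D2] -> scaled_block D (s, e) \in Ls.
  move=> sS; rewrite !inE !mem_cat.
  by case/or3P=> /eqP->; rewrite (mem_scaled_blocks _ _ sS) ?orbT.
pose j : 'Z_2 * F := (1, 0)%R.
have Ls_j C : C \in [set C in [seq [set x in l] | l <- Ls]] ->
    translate_block C j \in [set C in [seq [set x in l] | l <- Ls]].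
  rewrite !in_set => /mapP[l lL ->].
  have [-> {l lL}|[D [s [e [DD sS ->]]]]] : l = Z \/
      exists D s e, [/\ D \in [:: B; D1; D2], s \in S & l = scaled_block D (s, e)].
    move: lL; rewrite inE !mem_cat.
    case/predU1P=> [|/or3P[]/scaled_blocksP[s [e [sS ->]]]]; first by left.
    - by right; exists D1, s, e; rewrite !inE eqxx orbT.
    - by right; exists D2, s, e; rewrite !inE eqxx !orbT.
    - by right; exists B, s, e; rewrite !inE eqxx.
    (* [Z] is fixed by the translation, because [1 + 1 = 0] in ['Z_2]. *)
    apply/mapP; exists Z; rewrite ?mem_head //; apply/setP=> -[e x].
    rewrite mem_translate !inE -!pair_eqE /= !subr0 !subr_eq0 subr_eq.
    have := Z2P e; rewrite !inE => /orP[]/eqP->; rewrite /= ?eqxx ?orbF //.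
  rewrite translate_scaled_block; apply/mapP; exists (scaled_block D (s, e + 1)%R) => //.
  exact: mem_Ls.
have pdf : is_PDF (nseq (4 * n + 1) 2 ++ nseq (2 * n) 4) 2
    [set C in [seq [set x in l] | l <- Ls]].
  rewrite -sizeLs; apply: (@family_PDF _ j).
  - by [].
  - apply/allP=> l lL; have : size l \in [seq size l | l <- Ls] by apply: map_f.
    by rewrite sizeLs mem_cat !mem_nseq => /orP[]/andP[_ /eqP->].
  - by rewrite sizeLs cardG cardF sumn_cat !sumn_nseq; lia.
  - by rewrite sizeLs cardG cardF map_cat !map_nseq sumn_cat !sumn_nseq; lia.
  - move=> [e x]; have [->|x0] := eqVneq x 0%R.
      exists Z; first exact: mem_head.
      by have := Z2P e; rewrite !inE => /orP[]/eqP->; rewrite !eqxx ?orbT.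
    have [s [c [sS cD ->]]] := cov x x0.
    have [D DD {}cD] : exists2 D, D \in [:: B; D1; D2] & c \in D.
      by move: cD; rewrite !mem_cat => /or3P[]cD;
         [exists B|exists D1|exists D2]; rewrite ?inE ?eqxx ?orbT.
    (* The shift [e - c.1] brings the element [c] to level [e]. *)
    exists (scaled_block D (s, e - c.1)%R); first exact: mem_Ls.
    by apply/mapP; exists c => //=; rewrite addrC subrK.
  - exact: Ls_j.
  (* For [x = 0] the only nonzero difference is [(1, 0)], and [Z] supplies it. *)
  move=> [e x] ex0; have [x0|x0] := eqVneq x 0%R.
    exists Z, (1, 0)%R, (0, 0)%R; split; rewrite ?mem_head ?inE ?eqxx ?orbT //.
    have := Z2P e; rewrite x0 !inE => /orP[]/eqP eE.
      by rewrite eE x0 eqxx in ex0.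
    by rewrite eE; congr pair; rewrite /= subr0.
  have [s [D [a [b [sS DD /andP[aD bD] abE xE]]]]] := diff x e x0.
  exists (scaled_block D (s, 0)%R), (a.1, s * a.2)%R, (b.1, s * b.2)%R; split.
  - exact: mem_Ls.
  - by apply/mapP; exists a; rewrite //= addr0.
  - by apply/mapP; exists b; rewrite //= addr0.
  by rewrite -abE xE mulrBr.
exists [set C in [seq [set x in l] | l <- Ls]]; split=> //; rewrite -cardG.
apply: (PDF_base_class (j := j) _ pdf) => //.
- by move=> k; rewrite mem_cat !mem_nseq => /orP[]/andP[_ /eqP->].
move=> k; rewrite mem_cat !mem_nseq !inE.
by rewrite addn1 /= muln_gt0 n0.
Qed.

(** * Quartic residue classes *)

Lemma card_power_eq (F : finFieldType) (m : nat) (c : F) : 0 < m ->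
  #|[set x : F | x ^+ m == c]%R| <= m.
Proof.
move=> m0; pose p : {poly F} := ('X^m - c%:P)%R.
have sp : size p = m.+1 by rewrite size_XnsubC.
rewrite cardE -ltnS -sp max_poly_roots ?enum_uniq //.
  by rewrite -size_poly_gt0 sp.
by apply/allP=> x; rewrite mem_enum inE /root !hornerE subr_eq0.
Qed.

Lemma expf_card1 (F : finFieldType) (x : F) : (x != 0 -> x ^+ #|F|.-1 = 1)%R.
Proof.
move=> x0; apply: (mulfI x0); have F0 : 0 < #|F| by apply/card_gt0P; exists x.
by rewrite -exprS prednK // expf_card mulr1.
Qed.

(* A fourth root of unity for [x != 0], but [chi n 0 = 0]. *)
Definition chi (F : finFieldType) (n : nat) (x : F) : F := (x ^+ (2 * n))%R.

Lemma chiM (F : finFieldType) n (x y : F) : (chi n (x * y) = chi n x * chi n y)%R.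
Proof. exact: exprMn. Qed.

Lemma chiN (F : finFieldType) n (x : F) : chi n (- x)%R = chi n x.
Proof. by rewrite /chi exprM sqrrN -exprM. Qed.

Lemma chi0 (F : finFieldType) n : 0 < n -> chi n (0%R : F) = 0%R.
Proof. by case: n => // n _; rewrite /chi mulnS expr0n. Qed.

Lemma chi_eq0 (F : finFieldType) n (x : F) : 0 < n -> (chi n x == 0)%R = (x == 0)%R.
Proof. by move=> n0; rewrite expf_eq0 muln_gt0 n0. Qed.

Lemma chi1 (F : finFieldType) n : chi n (1%R : F) = 1%R.
Proof. exact: expr1n. Qed.

Definition unity4 (F : finFieldType) : {set F} := [set r : F | r ^+ 4 == 1]%R.

Lemma chi_unity4 (F : finFieldType) n (x : F) : #|F| = 8 * n + 1 ->
  (x != 0)%R -> chi n x \in unity4 F.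
Proof.
move=> cardF x0; rewrite inE -exprM; apply/eqP.
by rewrite -[RHS](expf_card1 x0) cardF; congr (_ ^+ _)%R; lia.
Qed.

(** Counting roots of polynomials gives at most 4 classes of at most [2 * n] elements each. The
    [8 * n] nonzero elements must fit into them, so both bounds are equalities. *)
Lemma quartic_class_sizes (F : finFieldType) n : 0 < n -> #|F| = 8 * n + 1 ->
  #|unity4 F| = 4 /\ forall r, r \in unity4 F -> #|[set x | chi n x == r]| = 2 * n.
Proof.
move=> n0 cardF.
have le2n r : #|[set x : F | chi n x == r]| <= 2 * n by apply: card_power_eq; lia.
have le4 : #|unity4 F| <= 4 by apply: card_power_eq.
have sumE : \sum_(r in unity4 F) #|[set x : F | chi n x == r]| = 8 * n.
  have -> : 8 * n = #|[set~ (0 : F)%R]| by rewrite cardsC1 cardF addn1.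
  rewrite -sum1_card [RHS](partition_big (chi n) (mem (unity4 F))) /=; last first.
    by move=> x; rewrite in_setC1; apply: chi_unity4.
  apply: eq_bigr => r rU; rewrite -sum1_card; apply: eq_bigl => x.
  rewrite !inE; case: eqP => //= [xr|]; rewrite ?andbF // andbT.
  apply/esym/eqP=> x0; move: rU; rewrite -xr x0 chi0 // inE expr0n /= eq_sym.
  by rewrite oner_eq0.
have U4 : #|unity4 F| = 4.
  apply/eqP; rewrite eqn_leq le4 leqNgt; apply/negP=> lt4.
  have : \sum_(r in unity4 F) #|[set x : F | chi n x == r]| <= 3 * (2 * n).
    apply: leq_trans (leq_sum _ (fun r _ => le2n r)) _.
    by rewrite sum_nat_const leq_mul2r -ltnS lt4 orbT.
  by rewrite sumE; lia.
split=> // r rU; apply/eqP; rewrite eqn_leq le2n leqNgt; apply/negP=> lt_r.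
move: sumE; rewrite (bigD1 r) //=.
have : \sum_(i in unity4 F | i != r) #|[set x : F | chi n x == i]| <= 3 * (2 * n).
  apply: leq_trans (leq_sum _ (fun r _ => le2n r)) _.
  rewrite sum_nat_const leq_mul2r; apply/orP; right.
  have := cardsD1 r (unity4 F); rewrite U4 rU add1n => -[->]; apply: eq_leq.
  by apply: eq_card => i; rewrite in_setD1 andbC.
move=> le6 sumE; move: (leq_add lt_r le6); rewrite addSn sumE; lia.
Qed.

Lemma unity4_surj (F : finFieldType) n (s : seq F) : 0 < n -> #|F| = 8 * n + 1 ->
    all (predC1 0%R) s -> size s = 4 -> uniq [seq chi n x | x <- s] ->
  forall x, (x != 0)%R -> exists2 y, y \in s & chi n x = chi n y.
Proof.
move=> n0 cardF s0 ss us x x0.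
have [U4 _] := quartic_class_sizes n0 cardF.
have sub : {subset [seq chi n x | x <- s] <= unity4 F}.
  by move=> _ /mapP[y ys ->]; apply: chi_unity4 => //; have := allP s0 _ ys.
have : chi n x \in [seq chi n x | x <- s].
  have [||_ ->] := uniq_min_size us (s2 := enum (unity4 F)).
  - by move=> r /sub; rewrite mem_enum.
  - by rewrite -cardE U4 size_map ss.
  by rewrite mem_enum chi_unity4.
by case/mapP=> y ys ->; exists y.
Qed.

(** From each pair [x], [- x] the element of smaller [enum_rank] is kept. *)
Lemma half_system (F : finZmodType) (K : {set F}) :
    (forall x, x \in K -> - x \in K)%R -> (forall x, x \in K -> - x != x)%R ->
  exists S : seq F, 2 * size S = #|K| /\
    forall x, x \in K -> (x \in S) || (- x \in S)%R.
Proof.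
move=> KN Kneq; pose S := [set x in K | enum_rank x < enum_rank (- x)%R].
exists (enum S); split; last first.
  move=> x xK; rewrite !mem_enum !inE xK KN // opprK /=.
  have := Kneq x xK; rewrite -(inj_eq enum_rank_inj) -(inj_eq val_inj) /=.
  by rewrite neq_ltn orbC.
rewrite -cardE mul2n -addnn -[in X in _ + X](card_imset _ (@oppr_inj F)).
rewrite -cardsUI; set I := _ :&: _.
have -> : I = set0.
  apply/setP=> x; rewrite !inE; apply/negP=> /andP[/andP[_ lt_x]] /imsetP[y].
  by rewrite inE => /andP[_ lt_y] xE; move: lt_x; rewrite xE opprK ltnNge ltnW.
rewrite cards0 addn0; apply: eq_card => x; rewrite !inE.
apply/orP/idP => [[/andP[]//|/imsetP[y]]|xK].
  by rewrite inE => /andP[yK _ ->]; apply: KN.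
have := Kneq x xK; rewrite -(inj_eq enum_rank_inj) -(inj_eq val_inj) /= neq_ltn.
case/orP=> lt_x; [right|left; by rewrite xK].
by apply/imsetP; exists (- x)%R; rewrite ?opprK // inE KN // opprK.
Qed.

(** Otherwise [-1 = 1], and then [r ^+ 4 = 1] forces [r = 1], against the four elements of
    [unity4]. *)
Lemma neq_opp (F : finFieldType) n (x : F) : 0 < n -> #|F| = 8 * n + 1 ->
  (x != 0 -> - x != x)%R.
Proof.
move=> n0 cardF x0; apply/eqP=> xE.
have [U4 _] := quartic_class_sizes n0 cardF.
have N1 : (- 1 = 1 :> F)%R by apply: (mulIf x0); rewrite mulN1r mul1r.
suff : unity4 F \subset [set 1%R] by move/subset_leq_card; rewrite U4 cards1.
apply/subsetP=> r; rewrite !inE (exprM r 2 2) sqrf_eq1 N1 orbb.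
by rewrite sqrf_eq1 N1 orbb.
Qed.

Lemma Z2_subC (a b : 'Z_2) : (a - b = b - a)%R.
Proof.
rewrite -[LHS]opprB; have := Z2P (b - a)%R; rewrite !inE => /orP[]/eqP->.
  exact: oppr0.
exact: val_inj.
Qed.

(** The multipliers [S] are one of each pair [s], [- s] with [chi n s = 1]. If [x] and [y] have the
    same class, then [x / y] lies in [S] only up to sign. For elements the sign is absorbed by [d],
    the negative of [c]; for differences by exchanging [a] and [b], which leaves the level
    difference unchanged in ['Z_2]. *)
Lemma quartic_family (F : finFieldType) (n : nat) (B D1 D2 : seq ('Z_2 * F)) :
    0 < n -> #|F| = 8 * n + 1 -> size B = 4 -> size D1 = 2 -> size D2 = 2 ->
    (forall x : F, x != 0%R -> exists c d,
       [/\ c \in B ++ D1 ++ D2, d \in B ++ D1 ++ D2, d.2 = - c.2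
         & chi n x = chi n c.2]%R) ->
    (forall (x : F) (e : 'Z_2), x != 0%R -> exists D a b,
       [/\ D \in [:: B; D1; D2], a \in D, b \in D, a.1 - b.1 = e
         & chi n x = chi n (a.2 - b.2)]%R) ->
  exists P : {set {set ('Z_2 * F)%type}},
    is_PDF (nseq (4 * n + 1) 2 ++ nseq (2 * n) 4) 2 P /\
    is_base_parallel_class (pred2 2 4) (2 * #|F|) P.
Proof.
move=> n0 cardF sizeB sizeD1 sizeD2 cov diff.
pose K : {set F} := [set x | chi n x == 1%R].
have K0 x : x \in K -> (x != 0)%R.
  by rewrite inE => /eqP xK; rewrite -(chi_eq0 x n0) xK oner_eq0.
have [S [sizeS KS]] : exists S : seq F, 2 * size S = #|K| /\
    forall x, x \in K -> (x \in S) || (- x \in S)%R.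
  apply: half_system => x xK; last by apply: neq_opp n0 cardF (K0 _ xK).
  by move: xK; rewrite !inE chiN.
have {}sizeS : size S = n.
  have [_ /(_ 1%R)] := quartic_class_sizes n0 cardF.
  by rewrite inE expr1n eqxx -/K -sizeS => /(_ isT) ?; lia.
have quot x y : (x != 0)%R -> chi n x = chi n y ->
    (x / y)%R \in S \/ (- (x / y))%R \in S.
  move=> x0 xy; apply/orP; apply: KS; have y0 : (y != 0)%R.
    by rewrite -(chi_eq0 y n0) -xy chi_eq0.
  have cy0 : (chi n y != 0)%R by rewrite chi_eq0.
  rewrite inE; apply/eqP/(mulIf cy0).
  by rewrite -chiM divfK // mul1r.
have divK x y : (x != 0)%R -> chi n x = chi n y -> (x = x / y * y)%R.
  by move=> x0 xy; rewrite divfK // -(chi_eq0 y n0) -xy chi_eq0.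
apply: (scaled_family n0 cardF sizeS sizeB sizeD1 sizeD2) => [x x0|x e x0].
  have [c [d [cE dE dc xc]]] := cov x x0.
  have [xS|xS] := quot _ _ x0 xc; first by exists (x / c.2)%R, c; rewrite -divK.
  by exists (- (x / c.2))%R, d; rewrite dc mulrNN -divK.
have [D [a [b [DD aD bD ab xab]]]] := diff x e x0.
have [xS|xS] := quot _ _ x0 xab.
  by exists (x / (a.2 - b.2))%R, D, a, b; rewrite -divK // aD bD.
exists (- (x / (a.2 - b.2)))%R, D, b, a; rewrite -[(b.2 - _)%R]opprB mulrNN -divK //.
split; rewrite ?aD ?bD // -ab.
exact: Z2_subC.
Qed.

(** The first list governs the elements, the second the differences with level 0, the third those
    with level 1. *)
Definition quartic_frame (F : finFieldType) n (b1 b2 b3 b4 : F) : bool :=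
  [&& uniq [seq chi n x | x <- [:: b1; b2; b3; b4]],
      uniq [seq chi n x | x <- [:: b1 - b3; b2 - b3; b1 - b2; b3 - b4]%R],
      uniq [seq chi n x | x <- [:: b1 - b4; b2 - b4; b1 - b2; b3 - b4]%R]
    & 0%R \notin [:: b1; b2; b3; b4; b1 - b3; b2 - b3; b1 - b4; b2 - b4; b1 - b2; b3 - b4]%R].

(** [D1] joins two levels and [D2] stays on one. So the class of [b1 - b2] comes from [B] on level 0
    and from [D1] on level 1, while that of [b3 - b4] comes from [D2] on level 0 and from [B] on
    level 1. *)
Lemma quartic_frame_class (F : finFieldType) n (b1 b2 b3 b4 : F) :
    0 < n -> #|F| = 8 * n + 1 -> quartic_frame n b1 b2 b3 b4 ->
  exists P : {set {set ('Z_2 * F)%type}},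
    is_PDF (nseq (4 * n + 1) 2 ++ nseq (2 * n) 4) 2 P /\
    is_base_parallel_class (pred2 2 4) (2 * #|F|) P.
Proof.
move=> n0 cardF /and4P[u u0 u1]; rewrite !inE !negb_or ![(0 == _)%R]eq_sym.
case/and5P=> b1_0 b2_0 b3_0 b4_0 /and5P[b13 b23 b14 b24 /andP[b12 b34]].
have u_0 : all (predC1 0%R) [:: b1; b2; b3; b4] by rewrite /= b1_0 b2_0 b3_0 b4_0.
have u0_0 : all (predC1 0%R) [:: b1 - b3; b2 - b3; b1 - b2; b3 - b4]%R.
  by rewrite /= b13 b23 b12 b34.
have u1_0 : all (predC1 0%R) [:: b1 - b4; b2 - b4; b1 - b2; b3 - b4]%R.
  by rewrite /= b14 b24 b12 b34.
pose B : seq ('Z_2 * F) := [:: (0, b1); (0, b2); (0, b3); (1, b4)]%R.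
pose D1 : seq ('Z_2 * F) := [:: (0, - b1); (1, - b2)]%R.
pose D2 : seq ('Z_2 * F) := [:: (0, - b3); (0, - b4)]%R.
apply: (@quartic_family F n B D1 D2) => // [x x0|x e x0].
  have [y yb ->] := unity4_surj n0 cardF u_0 (erefl 4) u x0.
  move: yb; rewrite !inE => /or4P[] /eqP->.
  - by exists (0, b1)%R, (0, - b1)%R; rewrite !inE !eqxx ?orbT.
  - by exists (0, b2)%R, (1, - b2)%R; rewrite !inE !eqxx ?orbT.
  - by exists (0, b3)%R, (0, - b3)%R; rewrite !inE !eqxx ?orbT.
  - by exists (1, b4)%R, (0, - b4)%R; rewrite !inE !eqxx ?orbT.
have chiNsub a b : chi n (a - b)%R = chi n (- a + b)%R by rewrite -chiN opprB addrC.
have := Z2P e; rewrite !inE => /orP[]/eqP->.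
  have [y yb ->] := unity4_surj n0 cardF u0_0 (erefl 4) u0 x0.
  move: yb; rewrite !inE => /or4P[] /eqP->.
  - by exists B, (0, b1)%R, (0, b3)%R; rewrite !inE !eqxx ?orbT subrr.
  - by exists B, (0, b2)%R, (0, b3)%R; rewrite !inE !eqxx ?orbT subrr.
  - by exists B, (0, b1)%R, (0, b2)%R; rewrite !inE !eqxx ?orbT subrr.
  - by exists D2, (0, - b3)%R, (0, - b4)%R; rewrite !inE !eqxx ?orbT subrr /= opprK chiNsub.
have [y yb ->] := unity4_surj n0 cardF u1_0 (erefl 4) u1 x0.
move: yb; rewrite !inE => /or4P[] /eqP->.
- by exists B, (0, b1)%R, (1, b4)%R; rewrite !inE !eqxx ?orbT; split=> //; apply: val_inj.
- by exists B, (0, b2)%R, (1, b4)%R; rewrite !inE !eqxx ?orbT; split=> //; apply: val_inj.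
- exists D1, (0, - b1)%R, (1, - b2)%R; rewrite !inE !eqxx ?orbT /= opprK chiNsub.
  by split=> //; apply: val_inj.
- by exists B, (0, b3)%R, (1, b4)%R; rewrite !inE !eqxx ?orbT; split=> //; apply: val_inj.
Qed.

(** * Frames in large fields *)

(** With [t = (z + d) / z], that is [z = d / (t - 1)], the condition becomes [chi n t = 1] and
    [t != 1]. *)
Lemma card_chi_shift (F : finFieldType) n (d : F) : 0 < n -> #|F| = 8 * n + 1 ->
  (d != 0)%R -> #|[set z : F | (z != 0) && (chi n (z + d) == chi n z)]%R| = (2 * n).-1.
Proof.
move=> n0 cardF d0.
have [_ /(_ 1%R)] := quartic_class_sizes n0 cardF.
rewrite inE expr1n eqxx => /(_ isT) cardK.
have K1 : 1%R \in [set x : F | chi n x == 1%R] by rewrite inE chi1.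
rewrite -cardK [in RHS](cardsD1 1%R) K1 add1n /=.
pose f (t : F) := (d / (t - 1))%R.
have finj : {in [set t : F | chi n t == 1%R] :\ 1%R &, injective f}.
  by move=> s t _ _ /(mulfI d0)/invr_inj/addIr.
rewrite -(card_in_imset finj); apply: eq_card => z; rewrite inE.
apply/andP/imsetP => [[z0 zd]|[t]].
  exists (1 + d / z)%R; last by rewrite /f [(1 + _)%R]addrC addrK invf_div mulrC divfK.
  rewrite !inE -subr_eq0 addrAC subrr add0r mulf_neq0 ?invr_neq0 //=.
  have cz0 : chi n z != 0%R by rewrite chi_eq0.
  by apply/eqP/(mulIf cz0); rewrite -chiM mul1r mulrDl divfK // mul1r (eqP zd).
rewrite !inE -subr_eq0 => /andP[t1 ct] ->; rewrite mulf_neq0 ?invr_neq0 //; split=> //.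
have -> : (f t + d = t * f t)%R.
  by rewrite /f; field.
by rewrite chiM (eqP ct) mul1r.
Qed.

(** * Second moments of class counts *)

Definition near (F : finFieldType) n (A : {set F}) (r x : F) : nat :=
  #|[set y in A | chi n (x - y)%R == r]|.

Lemma sum_near (F : finFieldType) n (A : {set F}) x : 0 < n -> #|F| = 8 * n + 1 ->
  \sum_(r in unity4 F) near n A r x = #|A :\ x|.
Proof.
move=> n0 cardF; rewrite -sum1_card.
rewrite [RHS](partition_big (fun y => chi n (x - y)%R) (mem (unity4 F))) /=.
  apply: eq_bigr => r rU; rewrite /near -sum1_card; apply: eq_bigl => y; rewrite !inE.
  case: eqP => [xyr|]; rewrite ?andbF // !andbT.
  suff -> : y != x by [].
  apply: contraTneq rU => yx; rewrite -xyr yx subrr chi0 // inE expr0n /=.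
  by rewrite eq_sym oner_eq0.
by move=> y; rewrite !inE => /andP[yx _]; have := @chi_unity4 F n (x - y)%R cardF;
   rewrite subr_eq0 eq_sym yx inE => ->.
Qed.

Lemma sum_sum_near (F : finFieldType) n (A : {set F}) : 0 < n -> #|F| = 8 * n + 1 ->
  \sum_x \sum_(r in unity4 F) near n A r x = #|A| * (8 * n).
Proof.
move=> n0 cardF; rewrite (eq_bigr _ (fun x _ => sum_near A x n0 cardF)).
have -> : #|A| * (8 * n) = \sum_(y in A) #|[set~ y]|.
  by rewrite (eq_bigr (fun=> 8 * n)) ?sum_nat_const // => y _; rewrite cardsC1 cardF addn1.
under eq_bigr => x _ do rewrite -sum1_card.
under [RHS]eq_bigr => x _ do rewrite -sum1_card.
rewrite (exchange_big_dep (mem A)) /=; last by move=> x y _; rewrite !inE => /andP[].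
apply: eq_bigr => y yA; apply: eq_bigl => x.
by rewrite !inE yA andbT eq_sym.
Qed.

(* For y <> y', the number of x with chi (x - y) = chi (x - y') does not depend
   on y and y'. *)
Lemma sum_near_sq (F : finFieldType) n (A : {set F}) : 0 < n -> #|F| = 8 * n + 1 ->
  \sum_x \sum_(r in unity4 F) near n A r x ^ 2 =
  #|A| * (8 * n) + #|A| * #|A|.-1 * (2 * n).-1.
Proof.
move=> n0 cardF.
(* The sum of squares at [x] counts the ordered pairs in [A] whose members have the same class as
   seen from [x]. The condition [x != u.1] discards the value 0 of [chi]. *)
pose E x : {set F * F} := [set u in setX A A |
  (x != u.1) && (chi n (x - u.1)%R == chi n (x - u.2)%R)].
have nearE x : \sum_(r in unity4 F) near n A r x ^ 2 = #|E x|.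
  rewrite -sum1_card (partition_big (fun u => chi n (x - u.1)%R) (mem (unity4 F))) /=.
    apply: eq_bigr => r rU; rewrite /near expnS expn1 -cardsX -sum1_card.
    apply: eq_bigl => -[y y']; rewrite !inE /=.
    case: (eqVneq (chi n (x - y)%R) r) => [xyr|]; rewrite ?andbF // !andbT xyr.
    rewrite andbA [r == _]eq_sym; suff -> : x != y by [].
    apply: contraTneq rU => xy; rewrite -xyr xy subrr chi0 // inE expr0n /=.
    by rewrite eq_sym oner_eq0.
  move=> u; rewrite inE => /andP[_ /andP[xu _]].
  by apply: chi_unity4; rewrite ?subr_eq0.
rewrite (eq_bigr _ (fun x _ => nearE x)).
under eq_bigr => x _ do rewrite -sum1_card.
rewrite (exchange_big_dep (mem (setX A A))) /=; last by move=> x u _; rewrite inE => /andP[].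
(* A diagonal pair is seen from every [x] but one. Off the diagonal, [z = x - y] reduces the count
   to [card_chi_shift] with [d = y - y']. *)
have innerE u : u \in setX A A -> \sum_(x | true && (u \in E x)) 1 =
    if u.1 == u.2 then 8 * n else (2 * n).-1.
  case: u => y y'; rewrite inE sum1dep_card /= => /andP[yA yA']; have [<-|yy'] := eqVneq y y'.
    rewrite -[8 * n](addnK 1) -cardF subn1 -(cardsC1 y).
    by apply: eq_card => x; rewrite !inE /= yA eqxx /= andbT.
  have d0 : (y - y' != 0)%R by rewrite subr_eq0.
  rewrite -(card_chi_shift n0 cardF d0) -[RHS](card_imset _ (addIr y)).
  apply: eq_card => x; rewrite !inE /= yA yA' /=.
  apply/andP/imsetP => [[xy /eqP xyy']|[z]].
    exists (x - y)%R; last by rewrite subrK.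
    by rewrite inE subr_eq0 xy addrA subrK xyy' eqxx.
  rewrite inE => /andP[z0 /eqP zE] ->; rewrite addrK -addrA zE eqxx.
  by rewrite -subr_eq0 addrK.
rewrite (eq_bigr _ innerE) (bigID (fun u : F * F => u.1 == u.2)) /=; congr addn.
  rewrite (eq_bigr (fun=> 8 * n)); last by move=> u /andP[_ ->].
  rewrite sum_nat_const; congr muln.
  rewrite -(card_imset _ (_ : injective (fun y : F => (y, y)))); last by move=> ? ? [].
  apply: eq_card => -[y y']; rewrite unfold_in /= !inE /=.
  apply/andP/imsetP => [[/andP[yA _] /eqP<-]|[z zA [-> ->]]]; first by exists y.
  by rewrite zA eqxx.
rewrite (eq_bigr (fun=> (2 * n).-1)); last by move=> u /andP[_ /negPf->].
rewrite sum_nat_const; congr muln.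
have -> : #|A| * #|A|.-1 = size (Delta A) by rewrite size_Delta.
rewrite size_map -(card_uniqP (filter_uniq _ (enum_uniq _))).
by apply: eq_card => u; rewrite mem_filter mem_enum unfold_in /= andbC.
Qed.

(** This is 16 times the squared distance between the class counts and the uniform value [#|A| / 4],
    scaled to stay integral. *)
Definition dev (F : finFieldType) n (A : {set F}) (x : F) : int :=
  (\sum_(r in unity4 F) ((4 * near n A r x)%:Z - #|A|%:Z) ^+ 2)%R.

Lemma dev_ge0 (F : finFieldType) n (A : {set F}) (x : F) : (0 <= dev n A x)%R.
Proof. by apply: sumr_ge0 => r _; apply: sqr_ge0. Qed.

(** When the square is expanded, the terms in [n * w ^ 2] cancel. The sum equals
    [(96 * n + 16) * w - 12 * w ^ 2], and the negative term is dropped. *)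
Lemma sum_dev (F : finFieldType) n (A : {set F}) : 0 < n -> #|F| = 8 * n + 1 ->
  (\sum_x dev n A x <= ((96 * n + 16) * #|A|)%:Z)%R.
Proof.
move=> n0 cardF; set w := #|A|.
have U4 := (quartic_class_sizes n0 cardF).1.
have devE x : (dev n A x = 16 * (\sum_(r in unity4 F) near n A r x ^ 2)%:Z
    - (8 * w)%:Z * (\sum_(r in unity4 F) near n A r x)%:Z + (4 * w ^ 2)%:Z)%R.
  rewrite !(big_morph Posz PoszD (erefl (Posz 0))) !mulr_sumr -sumrB.
  have -> : (Posz (4 * w ^ 2) = \sum_(r in unity4 F) Posz (w ^ 2))%R.
    by rewrite sumr_const U4 -mulr_natl; lia.
  rewrite -big_split; apply: eq_bigr => r _ /=; rewrite -/w; lia.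
rewrite (eq_bigr _ (fun x _ => devE x)) big_split sumrB /= -!mulr_sumr sumr_const.
rewrite -!(big_morph Posz PoszD (erefl (Posz 0))) sum_sum_near // sum_near_sq // cardF -/w.
have [->|w0] := posnP w; first by rewrite /=; lia.
rewrite -mulr_natl -(prednK w0) /=; nia.
Qed.

Lemma square_dev (F : finFieldType) n (A : {set F}) (x r : F) : r \in unity4 F ->
  (((4 * near n A r x)%:Z - #|A|%:Z) ^+ 2 <= dev n A x)%R.
Proof.
move=> rU; rewrite /dev (bigD1 r) //= lerDl.
by apply: sumr_ge0 => s _; apply: sqr_ge0.
Qed.

(** The empty class contributes [#|A| ^ 2]. The deviations of the other three add up to [#|A|], so
    their squares contribute at least a third of [#|A| ^ 2] more. *)
Lemma dev_empty_class (F : finFieldType) n (A : {set F}) (x h : F) :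
    0 < n -> #|F| = 8 * n + 1 -> h \in unity4 F -> x \notin A -> near n A h x = 0 ->
  ((4 * #|A| ^ 2)%:Z <= 3 * dev n A x)%R.
Proof.
move=> n0 cardF hU xA h0; have U4 := (quartic_class_sizes n0 cardF).1.
have := sum_near A x n0 cardF; rewrite (bigD1 h) //= h0 add0n => sumE.
have cardA : #|A :\ x| = #|A| by rewrite (cardsD1 x A) (negPf xA).
rewrite /dev (bigD1 h) //= h0 muln0 sub0r sqrrN.
set v := #|A| in cardA *; set s := (\sum_(i in _ | _) _)%R.
suff : ((v ^ 2)%:Z <= 3 * s)%R by lia.
have card3 : #|[pred r in unity4 F | r != h]| = 3.
  have := cardsD1 h (unity4 F); rewrite U4 hU add1n => -[->].
  by apply: eq_card => r; rewrite in_setD1 andbC.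
(* Cauchy-Schwarz for the three other classes, summed termwise from
   (3 (4 a - v) - v)^2 >= 0. *)
have : (\sum_(r in unity4 F | r != h)
    (6 * v%:Z * ((4 * near n A r x)%:Z - v%:Z) - v%:Z ^+ 2) <= 9 * s)%R.
  rewrite mulr_sumr; apply: ler_sum => r _; set a := near _ _ _ _.
  have := sqr_ge0 (3 * ((4 * a)%:Z - v%:Z) - v%:Z)%R; lia.
rewrite sumrB -mulr_sumr sumrB sumr_const.
rewrite -!(big_morph Posz PoszD (erefl (Posz 0))) -big_distrr /= sumE cardA.
rewrite sumr_const; rewrite card3; lia.
Qed.

Lemma unity4_avoid (F : finFieldType) n (s : seq F) : 0 < n -> #|F| = 8 * n + 1 ->
  size s <= 3 -> exists2 r, r \in unity4 F & r \notin s.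
Proof.
move=> n0 cardF s3; apply/subsetPn/negP=> /subset_leq_card.
have [-> _] := quartic_class_sizes n0 cardF.
by move=> /leq_trans/(_ (card_size s)); rewrite leqNgt ltnS s3.
Qed.

(* Candidates for b3 and b4 when b1 = 0 and b2 = 1; [h] is the class wanted for
   b3 - b4. *)
Definition triangle_apices (F : finFieldType) n (h : F) : {set F} :=
  [set x : F | uniq [:: 1; h; chi n x; chi n (x - 1)] & (x != 0) && (x != 1)]%R.

Lemma chi_quotient_shift (F : finFieldType) n : 0 < n -> #|F| = 8 * n + 1 ->
  #|[set x : F | (x != 0) && (chi n (x - 1) == chi n x)]%R| = (2 * n).-1.
Proof. by move=> n0 cardF; apply: card_chi_shift; rewrite ?oppr_eq0 ?oner_eq0. Qed.

Lemma card_bigcup_leq (I T : finType) (A : {set I}) (B : I -> {set T}) :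
  #|\bigcup_(i in A) B i| <= \sum_(i in A) #|B i|.
Proof.
elim/big_rec2: _ => [|i m C _ leC]; first by rewrite cards0.
by rewrite (leq_trans (leq_card_setU _ _).1) // leq_add2l.
Qed.

(** At most [6 * n - 1] points [x] have two equal classes among 1, [chi n x] and [chi n (x - 1)]; 0
    and 1 are among these, since [chi n (-1) = 1]. Each of the other points, at least [2 * n + 2] in
    number, is an apex for the remaining class [h], which is one of the three classes other than
    1. *)
Lemma large_triangle_apices (F : finFieldType) n : 0 < n -> #|F| = 8 * n + 1 ->
  exists2 h : F, h \in unity4 F & 2 * n + 2 <= 3 * #|triangle_apices n h|.
Proof.
move=> n0 cardF; have [U4 /(_ 1%R)] := quartic_class_sizes n0 cardF.
have U1 : 1%R \in unity4 F by rewrite inE expr1n.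
move=> /(_ U1) card1; apply/exists_inP; apply: contraT => /exists_inPn small.
have : \sum_(h in unity4 F) #|triangle_apices n h| <= 2 * n + 1.
  rewrite (bigD1 (1%R : F)) //= [X in X + _](_ : _ = 0) ?add0n; last first.
    by apply: eq_card0 => x; rewrite inE /= inE eqxx.
  rewrite -(leq_pmul2l (isT : 0 < 3)) big_distrr /=.
  apply: (@leq_trans (\sum_(h in unity4 F | h != 1%R) (2 * n + 1))).
    by apply: leq_sum => h /andP[hU _]; rewrite -ltnS -addnS ltnNge small.
  rewrite sum_nat_const leq_mul2r; apply/orP; right.
  have := cardsD1 1%R (unity4 F); rewrite U4 U1 add1n => -[->]; apply: eq_leq.
  by apply: eq_card => i; rewrite in_setD1 andbC.
pose X1 := [set x : F | chi n x == 1%R].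
pose X2 := [set x : F | chi n (x - 1)%R == 1%R].
pose X3 := [set x : F | (x != 0) && (chi n (x - 1) == chi n x)]%R.
have card2 : #|X2| = 2 * n.
  rewrite -card1 -[RHS](card_imset _ (addIr (1%R : F))); apply: eq_card => x.
  rewrite inE; apply/idP/imsetP => [xE|[y yE ->]]; last by rewrite addrK; rewrite inE in yE.
  by exists (x - 1)%R; rewrite ?subrK // inE.
have cover_all : [set: F] \subset
    X1 :|: X2 :|: X3 :|: \bigcup_(h in unity4 F) triangle_apices n h.
  apply/subsetP=> x _; rewrite !in_setU !(in_set (fun _ => _ == _)) in_set.
  have [//|cx] := eqVneq (chi n x) 1%R; have [//|cx1] := eqVneq (chi n (x - 1)%R) 1%R.
  have x0 : (x != 0)%R by apply: contraNneq cx1 => ->; rewrite sub0r chiN chi1.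
  have x1 : (x != 1)%R by apply: contraNneq cx => ->; rewrite chi1.
  rewrite x0 /=; have [//|cxx] := eqVneq (chi n (x - 1)%R) (chi n x).
  have [r rU] := unity4_avoid n0 cardF
    (isT : size [:: 1%R; chi n x; chi n (x - 1)%R] <= 3).
  rewrite !inE !negb_or => /and3P[r1 rx rx1]; apply/bigcupP; exists r => //.
  rewrite inE /= !inE !negb_or x0 x1 rx rx1 ![1%R == _]eq_sym r1 cx cx1.
  by rewrite [chi n x == _]eq_sym cxx.
have := subset_leq_card cover_all; rewrite cardsT cardF.
have := (leq_card_setU (X1 :|: X2 :|: X3)
   (\bigcup_(h in unity4 F) triangle_apices n h)).1.
have := (leq_card_setU (X1 :|: X2) X3).1; have := (leq_card_setU X1 X2).1.
have := card_bigcup_leq (unity4 F) (triangle_apices n).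
rewrite card1 card2 /X3 chi_quotient_shift //; lia.
Qed.

(** If [w - 4 * a] exceeded [w / 11], then [w ^ 2 / 121 < 17 * w], so [w < 2057]; but [w] is at
    least 2134. *)
Lemma near_large (n a w : nat) : 3200 <= n -> 2 * n + 2 <= 3 * w ->
  (((4 * a)%:Z - w%:Z) ^+ 2 <= (17 * w)%:Z)%R -> 10 * w <= 44 * a.
Proof. by rewrite expr2; nia. Qed.

(** The threshold 3200 is dictated here. The hypotheses give [4 * a * b] at least
    [100 * (n + 1) ^ 2 / 1089], which overtakes [288 * n + 48] a little before [n = 3200]. *)
Lemma no_edge_bound (n a b w : nat) : 3200 <= n -> 2 * n + 2 <= 3 * w ->
    10 * w <= 44 * a -> 10 * w <= 44 * b ->
  ~ (a%:Z * (4 * b ^ 2)%:Z <= 3 * ((96 * n + 16) * b)%:Z)%R.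
Proof.
move=> n_ge cardW wa wb le1; have b0 : 0 < b by lia.
have : 4 * a * b <= 3 * (96 * n + 16) by rewrite -(leq_pmul2r b0); lia.
by move: n_ge cardW wa wb; clear; nia.
Qed.

(** The frame is [0, 1, u, v] translated by [- o]. Its differences do not depend on [o]: they have
    the right classes when [u] and [v] are apices in [W] and [u - v] has class [h]. The point [o]
    only has to see [0, 1, u, v] in four distinct classes. *)
Lemma exists_quartic_frame (F : finFieldType) n : 3200 <= n -> #|F| = 8 * n + 1 ->
  exists b1 b2 b3 b4 : F, quartic_frame n b1 b2 b3 b4.
Proof.
move=> n_ge cardF; have n0 : 0 < n by lia.
have [h hU cardW] := large_triangle_apices n0 cardF.
set W := triangle_apices n h in cardW.
have [o [o0 o1 co devo]] : exists o : F, [/\ o != 0, o != 1,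
    chi n (o - 1) != chi n o & dev n W o <= (17 * #|W|)%:Z]%R.
  (* By [sum_dev] the mean deviation over these at least [6 * n] points is at most slightly more
     than [96 / 6 = 16] times [#|W|], hence the constant 17. *)
  pose O := ~: [set x : F | (x != 0) && (chi n (x - 1) == chi n x)]%R :\ 0%R :\ 1%R.
  have cardO : 6 * n <= #|O|.
    have := cardsC [set x : F | (x != 0) && (chi n (x - 1) == chi n x)]%R.
    rewrite chi_quotient_shift // cardF; set C := ~: _ => cardC.
    have E0 : #|C| = (0%R \in C) + #|C :\ 0%R| := cardsD1 _ _.
    have E1 : #|C :\ 0%R| = (1%R \in C :\ 0%R) + #|O| := cardsD1 _ _.
    by move: E0 E1 cardC; case: (_ \in _); case: (_ \in _); lia.
  suff /exists_inP[o] : [exists o in O, (dev n W o <= (17 * #|W|)%:Z)%R].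
    rewrite !inE negb_and negbK => /and3P[o1 o0 /orP[/idPn//|co]] devo.
    by exists o.
  apply: contraT => /exists_inPn big_dev.
  have : (\sum_(o in O) dev n W o <= \sum_x dev n W x)%R.
    by rewrite [leRHS](bigID (mem O)) lerDl sumr_ge0 // => x _; apply: dev_ge0.
  move=> /le_trans/(_ (sum_dev W n0 cardF)).
  have : (\sum_(o in O) (17 * #|W|).+1%:Z <= \sum_(o in O) dev n W o)%R.
    by apply: ler_sum => x /big_dev; lia.
  rewrite sumr_const -mulr_natl natz; move: cardO; set m := #|O|; nia.
(* The classes [f] and [g] left over by [chi n o] and [chi n (o - 1)] are those wanted for [u - o]
   and [v - o]. *)
have [f fU] := unity4_avoid n0 cardF (isT : size [:: chi n o; chi n (o - 1)%R] <= 3).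
rewrite !inE negb_or => /andP[fo fo1].
have [g gU] := unity4_avoid n0 cardF (isT : size [:: f; chi n o; chi n (o - 1)%R] <= 3).
rewrite !inE !negb_or => /and3P[gf go go1].
pose U := [set y in W | chi n (o - y)%R == f].
pose V := [set y in W | chi n (o - y)%R == g].
have large r : r \in unity4 F -> 10 * #|W| <= 44 * near n W r o.
  move=> rU; apply: near_large n_ge cardW _.
  exact: le_trans (square_dev n W o rU) devo.
have [u [v [uU vV cuv]]] : exists u v, [/\ u \in U, v \in V & chi n (u - v)%R = h].
  suff /exists_inP[u uU /exists_inP[v vV /eqP cuv]] :
      [exists u in U, exists v in V, chi n (u - v)%R == h] by exists u, v.
  apply: contraT => /exists_inPn no_edge.
  have cardU := large f fU; have cardV := large g gU.
  rewrite -[near _ _ _ _]/#|U| in cardU; rewrite -[near _ _ _ _]/#|V| in cardV.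
  (* Without an edge, every [u] in [U] sees no point of [V] in class [h]. It is also outside [V],
     since [f] and [g] differ, so [dev_empty_class] applies to each [u]. *)
  have : (\sum_(u in U) (4 * #|V| ^ 2)%:Z <= 3 * \sum_x dev n V x)%R.
    rewrite mulr_sumr [leRHS](bigID (mem U)) /= ler_wpDr ?sumr_ge0 //.
      by move=> x _; rewrite mulr_ge0 ?dev_ge0.
    apply: ler_sum => u uU; apply: (dev_empty_class n0 cardF hU).
      apply/negP; rewrite inE => /andP[_ /eqP og]; move: uU; rewrite inE og.
      by rewrite (negPf gf) andbF.
    apply: eq_card0 => v; rewrite inE; apply/negP=> /andP[vV cuv].
    by move/exists_inP: (no_edge u uU); apply; exists v.
  rewrite sumr_const => le_dev.
  case: (no_edge_bound n_ge cardW cardU cardV).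
  rewrite -[X in (X * _)%R]natz mulr_natl; apply: le_trans le_dev _.
  by rewrite ler_pM2l // sum_dev.
move: uU vV; rewrite !inE => /andP[/andP[uu uu01] /eqP cou] /andP[/andP[vu vu01] /eqP cov].
exists (0 - o)%R, (1 - o)%R, (u - o)%R, (v - o)%R.
have subo x y : ((x - o) - (y - o) = x - y)%R by rewrite opprB addrA subrK.
have chiB x y : chi n (x - y)%R = chi n (y - x)%R by rewrite -chiN opprB.
have unity_neq0 r : r \in unity4 F -> (r == 0)%R = false.
  by rewrite inE; apply: contraTF => /eqP->; rewrite expr0n /= eq_sym oner_eq0.
have chi_neq0 x r : r \in unity4 F -> chi n x = r -> (0 == x)%R = false.
  by move=> rU xr; rewrite eq_sym -(chi_eq0 x n0) xr unity_neq0.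
move: uu vu; rewrite /= !inE !negb_or => /and4P[/and3P[h1 u1 uo1] /andP[hu huo] uuo _].
case/and4P=> /and3P[_ v1 vo1] /andP[hv hvo] vvo _.
case/andP: uu01 => u0 u_1; case/andP: vu01 => v0 v_1.
have e0 x : chi n (0 - x)%R = chi n x by rewrite sub0r chiN.
have e01 : chi n (0 - 1 : F)%R = 1%R by rewrite e0 chi1.
have eu : chi n (u - o)%R = f by rewrite chiB.
have ev : chi n (v - o)%R = g by rewrite chiB.
have e1 x : chi n (1 - x)%R = chi n (x - 1)%R by rewrite chiB.
apply/and4P; split; rewrite /= ?subo ?e01 ?e0 ?e1 ?eu ?ev ?cuv !inE !negb_or.
- rewrite [chi n o == _]eq_sym co ![chi n _ == f]eq_sym ![chi n _ == g]eq_sym.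
  by rewrite fo fo1 go go1 [f == g]eq_sym gf.
- rewrite ![chi n _ == 1%R]eq_sym ![chi n _ == h]eq_sym.
  by rewrite uuo u1 uo1 h1 hu huo.
- rewrite ![chi n _ == 1%R]eq_sym ![chi n _ == h]eq_sym.
  by rewrite vvo v1 vo1 h1 hv hvo.
rewrite (chi_neq0 _ _ fU eu) (chi_neq0 _ _ gU ev) (chi_neq0 _ _ hU cuv).
rewrite ![0%R == (_ - _)%R]eq_sym !subr_eq0 ![0%R == _]eq_sym ![1%R == _]eq_sym.
by rewrite o0 o1 u0 u_1 v0 v_1 [(0 == 1)%R]eq_sym oner_eq0.
Qed.

(** * Frames in small fields *)

(* A list of coefficients, lowest degree first, represents the value at an element
   [t] of F with t ^ k = r(t); [p] is zero in F.  Reduction is sound whether or not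
   X ^ k - r is irreducible. *)
Fixpoint vadd (p : N) (l1 l2 : seq N) : seq N :=
  match l1, l2 with
  | [::], _ => l2
  | _, [::] => l1
  | a :: l1', b :: l2' => N.modulo (N.add a b) p :: vadd p l1' l2'
  end.

Definition vscale (p c : N) (l : seq N) : seq N :=
  [seq N.modulo (N.mul c a) p | a <- l].

Definition vsub (p : N) (l1 l2 : seq N) : seq N :=
  vadd p l1 (vscale p (N.pred p) l2).

Definition pmul (p : N) (l1 l2 : seq N) : seq N :=
  foldr (fun a acc => vadd p (vscale p a l2) (N0 :: acc)) [::] l1.

(** Horner scheme in [l1]: [N0 :: acc] multiplies by [t], and the coefficients from degree [k] on
    are folded back through [t ^ k = r(t)]. *)
Definition vmul (p : N) (k : nat) (r l1 l2 : seq N) : seq N :=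
  foldr (fun a acc =>
           if acc is [::] then vscale p a l2 else
             let m := N0 :: acc in
             vadd p (vscale p a l2) (vadd p (take k m) (pmul p (drop k m) r)))
        [::] l1.

Fixpoint vexp (p : N) (k : nat) (r l : seq N) (e : positive) : seq N :=
  match e with
  | xH => l
  | xO e' => let y := vexp p k r l e' in vmul p k r y y
  | xI e' => let y := vexp p k r l e' in vmul p k r l (vmul p k r y y)
  end.

Definition veval (A : comNzRingType) (t : A) (l : seq N) : A :=
  foldr (fun a acc => (N.to_nat a)%:R + t * acc)%R 0%R l.

Lemma natr_mod (A : comNzRingType) (p a : N) : ((N.to_nat p)%:R = 0 :> A)%R ->
  ((N.to_nat (N.modulo a p))%:R = (N.to_nat a)%:R :> A)%R.
Proof.
move=> p0; rewrite [in RHS](N.div_mod' a p) N2Nat.inj_add N2Nat.inj_mul.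
by rewrite natrD natrM p0 mul0r add0r.
Qed.

Lemma veval_add (A : comNzRingType) (t : A) p l1 l2 : ((N.to_nat p)%:R = 0 :> A)%R ->
  veval t (vadd p l1 l2) = (veval t l1 + veval t l2)%R.
Proof.
move=> p0; elim: l1 l2 => [|a l1 IH] [|b l2]; rewrite /= ?add0r ?addr0 //.
by rewrite natr_mod // N2Nat.inj_add natrD IH mulrDr addrACA.
Qed.

Lemma veval_scale (A : comNzRingType) (t : A) p c l : ((N.to_nat p)%:R = 0 :> A)%R ->
  veval t (vscale p c l) = ((N.to_nat c)%:R * veval t l)%R.
Proof.
move=> p0; elim: l => [|a l IH] /=; first by rewrite mulr0.
by rewrite natr_mod // N2Nat.inj_mul natrM IH mulrDr mulrCA.
Qed.

Lemma veval_sub (A : comNzRingType) (t : A) p l1 l2 : p != N0 ->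
  ((N.to_nat p)%:R = 0 :> A)%R ->
  veval t (vsub p l1 l2) = (veval t l1 - veval t l2)%R.
Proof.
move=> p_neq0 p0; rewrite /vsub veval_add // veval_scale //.
suff -> : ((N.to_nat (N.pred p))%:R = -1 :> A)%R by rewrite mulN1r.
apply/eqP; rewrite -addr_eq0 natr1 -p0; apply/eqP; congr (_%:R)%R.
by move/eqP: p_neq0; lia.
Qed.

Lemma veval_pmul (A : comNzRingType) (t : A) p l1 l2 : ((N.to_nat p)%:R = 0 :> A)%R ->
  veval t (pmul p l1 l2) = (veval t l1 * veval t l2)%R.
Proof.
move=> p0; elim: l1 => [|a l1 IH] /=; first by rewrite mul0r.
by rewrite veval_add // veval_scale // /= IH add0r mulrDl mulrA.
Qed.

Lemma veval_take_drop (A : comNzRingType) (t : A) k l :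
  veval t l = (veval t (take k l) + t ^+ k * veval t (drop k l))%R.
Proof.
elim: k l => [|k IH] [|a l] /=; rewrite ?mulr0 ?addr0 ?expr0 ?mul1r ?add0r //.
by rewrite [in LHS]IH mulrDr addrA exprS mulrA.
Qed.

Lemma veval_mul (A : comNzRingType) (t : A) p k r l1 l2 :
    ((N.to_nat p)%:R = 0 :> A)%R -> (t ^+ k)%R = veval t r ->
  veval t (vmul p k r l1 l2) = (veval t l1 * veval t l2)%R.
Proof.
move=> p0 tk; elim: l1 => [|a l1 IH]; first by rewrite /= mul0r.
move: IH; rewrite /= -/(vmul p k r l1 l2); case: (vmul p k r l1 l2) => [|b m] IH.
  by rewrite veval_scale // mulrDl -mulrA -IH /= mulr0 addr0.
rewrite !veval_add // veval_scale // veval_pmul // -tk.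
rewrite [(veval t (drop _ _) * _)%R]mulrC -veval_take_drop /= in IH *.
by rewrite IH add0r mulrDl mulrA.
Qed.

Lemma veval_exp (A : comNzRingType) (t : A) p k r l e :
    ((N.to_nat p)%:R = 0 :> A)%R -> (t ^+ k)%R = veval t r ->
  veval t (vexp p k r l e) = (veval t l ^+ Pos.to_nat e)%R.
Proof.
move=> p0 tk; elim: e => [e IH|e IH|] //=; rewrite !veval_mul // IH -exprD.
  by rewrite -exprS; congr (_ ^+ _)%R; lia.
by congr (_ ^+ _)%R; lia.
Qed.

Definition vone (k : nat) : seq N := 1%num :: nseq k.-1 N0.

Definition vneg (p : N) (k : nat) (l : seq N) : seq N := vsub p (nseq k N0) l.

(** Each value must be literally one of the lists for 1, [i], -1, [- i]. These have distinct values
    in the field once [i] squares to -1, so comparing lists decides equality there. *)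
Definition check_classes (p : N) (k : nat) (r i : seq N) (vals : seq (seq N))
    (masks : seq bitseq) : bool :=
  [&& vmul p k r i i == vneg p k (vone k),
      all [in [:: vone k; i; vneg p k (vone k); vneg p k i]] vals
    & all (fun m => uniq (mask m vals)) masks].

(** The masks pick out of the ten entries of [frame_edges] the three lists required to be [uniq] in
    [quartic_frame]. *)
Definition frame_masks : seq bitseq :=
  [:: nseq 4 true; nseq 4 false ++ [:: true; true; false; false; true; true];
      nseq 6 false ++ nseq 4 true].

Definition frame_edges (p : N) (b1 b2 b3 b4 : seq N) : seq (seq N) :=
  [:: b1; b2; b3; b4; vsub p b1 b3; vsub p b2 b3; vsub p b1 b4; vsub p b2 b4;
      vsub p b1 b2; vsub p b3 b4].

(** A square root of -1 is sought among the computed classes themselves. If there is none, the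
    default [[::]] fails the test on its square. *)
Definition check_powers (p : N) (k : nat) (r : seq N) (e : positive)
    (xs : seq (seq N)) (masks : seq bitseq) : bool :=
  (fun vals => check_classes p k r
     (head [::] [seq x <- vals | vmul p k r x x == vneg p k (vone k)]) vals masks)
  [seq vexp p k r x e | x <- xs].

Lemma uniq_map_inj (T1 T2 : eqType) (f : T1 -> T2) (s : seq T1) :
  uniq [seq f x | x <- s] -> {in s &, injective f}.
Proof.
elim: s => //= a s IH /andP[fa us] x y; rewrite !inE.
case/predU1P=> [->|xs] /predU1P[->|ys] // fxy.
- by rewrite fxy map_f in fa.
- by rewrite -fxy map_f in fa.
- exact: IH.
Qed.

Lemma veval_nseq0 (A : comNzRingType) (t : A) k : veval t (nseq k N0) = 0%R.
Proof. by elim: k => //= k ->; rewrite mulr0 add0r. Qed.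

(** Evaluation at [t] is injective on the four lists in [roots], because -1 differs from 1 in [F].
    Distinct lists therefore stand for distinct classes, and none of them stands for 0. *)
Lemma check_powersP (F : finFieldType) n (t : F) p k r e xs masks :
    0 < n -> #|F| = 8 * n + 1 -> p != N0 -> ((N.to_nat p)%:R = 0 :> F)%R ->
    (t ^+ k)%R = veval t r -> Pos.to_nat e = 2 * n ->
    check_powers p k r e xs masks ->
  0%R \notin [seq veval t x | x <- xs] /\
  forall m, m \in masks -> uniq [seq chi n (veval t x) | x <- mask m xs].
Proof.
move=> n0 cardF p_neq0 p0 tk e2n; rewrite /check_powers /check_classes.
set i := head _ _; set vals := [seq _ | x <- xs]; set roots := [:: _; i; _; _].
case/and3P=> /eqP ii /allP in_roots /allP uniq_masks.
have cE x : veval t (vexp p k r x e) = chi n (veval t x) by rewrite veval_exp // e2n.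
have one1 : veval t (vone k) = 1%R by rewrite /= veval_nseq0 mulr0 addr0.
have negE l : veval t (vneg p k l) = (- veval t l)%R.
  by rewrite veval_sub // veval_nseq0 sub0r.
have i2 : (veval t i * veval t i = -1)%R by rewrite -(veval_mul _ _ p0 tk) ii negE one1.
have N1 : (- 1 != 1 :> F)%R by apply: neq_opp n0 cardF (oner_neq0 _).
have rootsE : [seq veval t x | x <- roots] = [:: 1; veval t i; - 1; - veval t i]%R.
  by rewrite /roots !map_cons !negE one1.
have j0 : veval t i != 0%R.
  by apply/eqP=> j0; move/eqP: i2; rewrite j0 mul0r eq_sym oppr_eq0 oner_eq0.
have roots0 : 0%R \notin [seq veval t x | x <- roots].
  rewrite rootsE !inE !negb_or ![(0 == _)%R]eq_sym !oppr_eq0.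
  by rewrite oner_neq0 j0.
have inj : {in roots &, injective (veval t)}.
  apply: uniq_map_inj; rewrite rootsE; move: (veval t i) i2 j0 => j jj j0.
  have j1 : (j != 1)%R by apply: contraNneq N1 => j1; rewrite -jj j1 mulr1.
  have jN1 : (j != -1)%R.
    by apply: contraNneq N1 => jN1; rewrite -[X in X == _]jj jN1 mulrNN mulr1.
  have jNj : (- j != j)%R by apply: neq_opp n0 cardF j0.
  rewrite /= !inE !negb_or eqr_opp eq_sym j1 eq_sym N1 eq_sym.
  by rewrite eqr_oppLR jN1 [(j == - j)%R]eq_sym jNj.
split.
  apply/mapP=> -[x xs_x x0]; have xr : vexp p k r x e \in roots.
    by apply: in_roots; apply: map_f.
  have := map_f (veval t) xr; rewrite cE -x0 chi0 //.
  by apply/negP.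
move=> m /uniq_masks; rewrite /vals -map_mask -[in X in _ -> X](eq_map cE) => um.
rewrite (map_comp (veval t)) map_inj_in_uniq // => y z /mapP[y' my ->] /mapP[z' mz ->].
by apply: inj; apply: in_roots; apply: map_f; apply: mem_mask; eassumption.
Qed.

Lemma check_frameP (F : finFieldType) n (t : F) p k r e b1 b2 b3 b4 :
    0 < n -> #|F| = 8 * n + 1 -> p != N0 -> ((N.to_nat p)%:R = 0 :> F)%R ->
    (t ^+ k)%R = veval t r -> Pos.to_nat e = 2 * n ->
    check_powers p k r e (frame_edges p b1 b2 b3 b4) frame_masks ->
  quartic_frame n (veval t b1) (veval t b2) (veval t b3) (veval t b4).
Proof.
move=> n0 cardF p_neq0 p0 tk e2n chk.
have [nz u] := check_powersP n0 cardF p_neq0 p0 tk e2n chk.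
have subE := fun x y => veval_sub t x y p_neq0 p0.
have := nz; have := u (nth [::] frame_masks 0); have := u (nth [::] frame_masks 1).
have := u (nth [::] frame_masks 2); rewrite !mem_nth // /frame_edges.
rewrite !map_cons !subE => /(_ isT) u4 /(_ isT) u3 /(_ isT) u1 {}nz.
apply/and4P; split=> //.
Qed.

(* The test says that X ^ q = X modulo X ^ k - r, so every root of X ^ k - r in an
   extension of F lies in F. *)
Lemma root_in_field (F : finFieldType) (p : N) (k : nat) (r l : seq N) (q : positive) :
    #|F| = Pos.to_nat q -> ((N.to_nat p)%:R = 0 :> F)%R -> size r <= k -> 0 < k ->
    vexp p k r (N0 :: 1%num :: l) q == N0 :: 1%num :: l -> all (pred1 N0) l ->
  exists t : F, (t ^+ k)%R = veval t r.
Proof.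
move=> cardF p0 le_rk k0 /eqP frob /all_pred1P l0.
pose h : {poly F} := ('X^k - veval 'X r)%R.
have veval_size (s : seq N) : size (veval 'X%R s : {poly F}) <= size s.
  elim: s => [|a s IH] /=; first by rewrite size_poly0.
  rewrite -polyC_natr (leq_trans (size_polyD _ _)) // geq_max.
  rewrite (leq_trans (size_polyC_leq1 _)) //= mulrC.
  by have [->|nz] := eqVneq (veval 'X%R s : {poly F}) 0%R; rewrite ?mul0r ?size_poly0 // size_mulX.
have size_h : size h = k.+1.
  by rewrite size_polyDl ?size_polyXn // size_polyN ltnS (leq_trans (veval_size r)).
have h0 : h != 0%R by rewrite -size_poly_gt0 size_h.
have [L [rs hE _]] := FinSplittingFieldFor h0.
have : size (map_poly (in_alg L) h) = k.+1 by rewrite size_map_poly.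
rewrite (eqp_size hE) size_prod_XsubC => -[size_rs].
case: rs => [|t rs] in hE size_rs; first by rewrite -size_rs in k0.
have : root (map_poly (in_alg L) h) t by rewrite (eqp_root hE) root_prod_XsubC mem_head.
have p0L : ((N.to_nat p)%:R = 0 :> L)%R by rewrite -(rmorph_nat (in_alg L)) p0 rmorph0.
have vevalL (s : seq N) (x : L) : ((map_poly (in_alg L) (veval 'X s)).[x] = veval x s)%R.
  elim: s => [|a s IH] /=; first by rewrite rmorph0 horner0.
  by rewrite rmorphD rmorphM /= map_polyX rmorph_nat !hornerE IH /= -polyC_natr hornerC.
rewrite rootE /h rmorphB rmorphXn /= map_polyX !hornerE vevalL subr_eq0 => /eqP tk.
have evX : veval t (N0 :: 1%num :: l) = t.
  by rewrite l0 /= veval_nseq0 mulr0 addr0 mulr1 add0r.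
(* The checked congruence, evaluated at [t], says [t ^ q = t]. *)
have : root (map_poly (in_alg L) ('X^#|F| - 'X)%R) t.
  rewrite rootE rmorphB rmorphXn /= map_polyX !hornerE cardF -{1}evX.
  by rewrite -(veval_exp _ _ p0L tk) frob evX subrr.
(* Over [L] the polynomial [X ^ q - X] is the product of the [X - x] with [x] in [F], so [t] is the
   image of such an [x]. *)
rewrite finField_genPoly rmorph_prod /= rootE horner_prod prodf_seq_eq0.
case/hasP=> x _; rewrite rmorphB /= map_polyX map_polyC /= !hornerE subr_eq0 => /eqP tx.
exists x; apply: (fmorph_inj (in_alg L)); rewrite rmorphXn /= -tx tk.
elim: (r) => [|a s IH] /=; first by rewrite scale0r.
by rewrite -/(in_alg L _) rmorphD rmorphM rmorph_nat /= -tx IH.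
Qed.

(** * The table of frames and its verification *)

Definition entry : Type := (N * nat * seq N * (seq N * seq N * seq N))%type.

Definition power_entry (p : N) (k : nat) (r b2 b3 b4 : seq N) : entry :=
  (p, k, r, (b2, b3, b4)).

(** A prime field is presented by the relation [t ^ 1 = 0], with constants as elements. *)
Definition prime_entry (p b2 b3 b4 : N) : entry :=
  power_entry p 1 [::] [:: b2] [:: b3] [:: b4].

Definition entry_card (w : entry) : N := let: (p, k, _, _) := w in N.pow p (N.of_nat k).

(** For [q = 8 * n + 1] the quotient by 4 is [2 * n], the exponent of [chi]. When [k > 1], [x] is
    the indeterminate padded to [k] coefficients, and the test on it provides a root in the
    field. *)
Definition check_entry (w : entry) : bool :=
  let: (p, k, r, (b2, b3, b4)) := w in
  match entry_card w, N.div (entry_card w) 4 with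
  | Npos q, Npos e =>
    [&& p != N0, 0 < k, size r <= k,
        if k == 1 then r == [::] else
          let x := N0 :: 1%num :: nseq (k - 2) N0 in vexp p k r x q == x
      & check_powers p k r e (frame_edges p (vone k) b2 b3 b4) frame_masks]
  | _, _ => false
  end.

(* A prime power [q] divides the 16th power of each of its divisors [d > 1],
   provided [q < 2 ^ 16]. *)
Fixpoint not_prime_power (fuel : nat) (d q : N) : bool :=
  if fuel is fuel'.+1 then
    if N.modulo q d == N0 then N.modulo (N.pow d 16) q != N0
    else not_prime_power fuel' (d + 2) q
  else false.

(** Each of [q, q + 8, ...] is either the next entry of the table or shown not to be a prime power.
    With fuel 80 the trial divisors are 3, 5, ..., 161, which pass the square root of every [q] met
    here. *)
Fixpoint sweep (m : nat) (q : N) (ws : seq entry) : bool :=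
  if m is m'.+1 then
    if ws is w :: ws' then
      if entry_card w == q then
        if check_entry w then sweep m' (q + 8) ws' else false
      else if not_prime_power 80 3 q then sweep m' (q + 8) ws else false
    else if not_prime_power 80 3 q then sweep m' (q + 8) ws else false
  else true.

Local Open Scope N_scope.

(* The primes and prime powers q = 8 n + 1 with 17 < q < 25601; b1 is always 1. *)
Definition frame_table : seq entry := [::
  power_entry 5 2%N [:: 3; 0] [:: 0; 2] [:: 4; 2] [:: 3; 3]; prime_entry 41 17 28 20;
  power_entry 7 2%N [:: 6; 0] [:: 2; 2] [:: 1; 3] [:: 2; 1]; prime_entry 73 12 5 11;
  power_entry 3 4%N [:: 1; 0; 0; 2] [:: 1; 0; 0; 1] [:: 1; 1; 0; 0] [:: 0; 0; 1; 0];
  prime_entry 89 14 26 17; prime_entry 97 8 10 5; prime_entry 113 20 9 12;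
  power_entry 11 2%N [:: 10; 0] [:: 2; 3] [:: 0; 2] [:: 3; 1]; prime_entry 137 5 10 7;
  power_entry 13 2%N [:: 11; 0] [:: 1; 4] [:: 2; 0] [:: 0; 4]; prime_entry 193 18 10 15;
  prime_entry 233 28 3 27; prime_entry 241 12 21 7; prime_entry 257 21 3 10;
  prime_entry 281 9 21 6; power_entry 17 2%N [:: 14; 0] [:: 0; 4] [:: 3; 0] [:: 1; 3];
  prime_entry 313 15 17 2; prime_entry 337 12 17 11; prime_entry 353 15 5 14;
  power_entry 19 2%N [:: 18; 0] [:: 2; 1] [:: 1; 3] [:: 2; 2]; prime_entry 401 6 9 3;
  prime_entry 409 23 14 22; prime_entry 433 11 14 7; prime_entry 449 6 9 3;
  prime_entry 457 12 20 10; prime_entry 521 8 3 6;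
  power_entry 23 2%N [:: 22; 0] [:: 2; 2] [:: 1; 3] [:: 2; 1]; prime_entry 569 6 9 3;
  prime_entry 577 30 34 13; prime_entry 593 10 17 6; prime_entry 601 30 19 29;
  prime_entry 617 22 6 17;
  power_entry 5 4%N [:: 3; 0; 0; 0] [:: 0; 0; 1; 0] [:: 1; 1; 1; 0] [:: 1; 1; 0; 1];
  prime_entry 641 7 3 6; prime_entry 673 22 6 17;
  power_entry 3 6%N [:: 2; 0; 0; 0; 1; 0] [:: 0; 1; 1; 0; 0; 1] [:: 0; 0; 0; 1; 0; 0] [:: 1; 0; 0; 0; 0; 1];
  prime_entry 761 6 9 3; prime_entry 769 18 22 11; prime_entry 809 12 20 17;
  power_entry 29 2%N [:: 27; 0] [:: 2; 0] [:: 0; 3] [:: 0; 1]; prime_entry 857 7 8 6;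
  prime_entry 881 15 3 13; prime_entry 929 6 9 3; prime_entry 937 41 10 38;
  prime_entry 953 8 3 6; power_entry 31 2%N [:: 30; 0] [:: 5; 1] [:: 1; 3] [:: 4; 1];
  prime_entry 977 12 6 7; prime_entry 1009 23 5 22; prime_entry 1033 24 10 15;
  prime_entry 1049 5 15 12; prime_entry 1097 18 6 7; prime_entry 1129 18 26 13;
  prime_entry 1153 15 5 11; prime_entry 1193 14 6 9; prime_entry 1201 31 34 5;
  prime_entry 1217 10 18 6; prime_entry 1249 12 21 14; prime_entry 1289 18 6 13;
  prime_entry 1297 18 20 10; prime_entry 1321 26 7 20; prime_entry 1361 8 3 6;
  power_entry 37 2%N [:: 35; 0] [:: 0; 3] [:: 1; 1] [:: 0; 2]; prime_entry 1409 13 3 9;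
  prime_entry 1433 11 14 5; prime_entry 1481 20 21 15; prime_entry 1489 14 18 7;
  prime_entry 1553 27 9 19; prime_entry 1601 34 6 18; prime_entry 1609 24 28 21;
  prime_entry 1657 14 6 7; power_entry 41 2%N [:: 38; 0] [:: 3; 0] [:: 4; 2] [:: 0; 3];
  prime_entry 1697 14 24 2; prime_entry 1721 15 18 7; prime_entry 1753 15 3 13;
  prime_entry 1777 5 15 12; prime_entry 1801 39 5 31;
  power_entry 43 2%N [:: 42; 0] [:: 2; 5] [:: 0; 2] [:: 3; 3]; prime_entry 1873 18 20 10;
  prime_entry 1889 38 9 37; prime_entry 1913 14 6 13; prime_entry 1993 21 13 20;
  prime_entry 2017 20 2 17; prime_entry 2081 6 9 3; prime_entry 2089 12 21 14;
  prime_entry 2113 15 5 11; prime_entry 2129 12 27 9; prime_entry 2137 21 10 20;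
  prime_entry 2153 14 5 10; prime_entry 2161 22 28 21;
  power_entry 47 2%N [:: 46; 0] [:: 4; 2] [:: 6; 5] [:: 3; 1]; prime_entry 2273 30 14 29;
  prime_entry 2281 42 6 34; prime_entry 2297 10 15 5; prime_entry 2377 20 2 19;
  prime_entry 2393 14 6 13;
  power_entry 7 4%N [:: 6; 0; 0; 6] [:: 0; 1; 0; 0] [:: 0; 1; 1; 1] [:: 1; 0; 1; 0];
  prime_entry 2417 8 3 6; prime_entry 2441 18 34 22; prime_entry 2473 38 25 35;
  prime_entry 2521 20 33 22; prime_entry 2593 47 11 46; prime_entry 2609 8 3 6;
  prime_entry 2617 15 18 7; prime_entry 2633 8 3 6; prime_entry 2657 26 5 18;
  prime_entry 2689 39 14 26; prime_entry 2713 12 15 5; prime_entry 2729 3 24 17;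
  prime_entry 2753 8 3 6; prime_entry 2777 9 19 13; prime_entry 2801 6 9 3;
  power_entry 53 2%N [:: 51; 0] [:: 2; 0] [:: 3; 3] [:: 1; 3]; prime_entry 2833 14 25 11;
  prime_entry 2857 23 11 13; prime_entry 2897 7 19 17; prime_entry 2953 14 6 7;
  prime_entry 2969 14 17 3; prime_entry 3001 8 26 13; prime_entry 3041 14 7 8;
  prime_entry 3049 34 5 31; prime_entry 3089 14 15 3; prime_entry 3121 29 6 17;
  prime_entry 3137 48 9 27; prime_entry 3169 20 7 14; prime_entry 3209 8 3 6;
  prime_entry 3217 27 10 15; prime_entry 3257 12 17 11; prime_entry 3313 11 20 7;
  prime_entry 3329 7 3 6; prime_entry 3361 27 33 11; prime_entry 3433 15 7 12;
  prime_entry 3449 18 7 12; prime_entry 3457 15 2 7;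
  power_entry 59 2%N [:: 58; 0] [:: 2; 1] [:: 1; 3] [:: 2; 2]; prime_entry 3529 39 10 23;
  prime_entry 3593 14 5 10; prime_entry 3617 7 23 3; prime_entry 3673 38 41 10;
  prime_entry 3697 25 10 20; power_entry 61 2%N [:: 59; 0] [:: 0; 1] [:: 3; 3] [:: 3; 2];
  prime_entry 3761 20 30 3; prime_entry 3769 7 22 8; prime_entry 3793 3 20 10;
  prime_entry 3833 14 6 13; prime_entry 3881 6 9 3; prime_entry 3889 39 22 35;
  prime_entry 3929 22 2 21; prime_entry 4001 18 37 34; prime_entry 4049 14 3 9;
  prime_entry 4057 29 31 14; prime_entry 4073 12 5 8; prime_entry 4129 14 7 8;
  prime_entry 4153 15 28 11; prime_entry 4177 22 24 21; prime_entry 4201 24 11 23;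
  prime_entry 4217 12 5 11; prime_entry 4241 14 17 11; prime_entry 4273 15 24 7;
  prime_entry 4289 13 14 3; prime_entry 4297 30 47 25; prime_entry 4337 14 5 10;
  prime_entry 4409 18 7 12; prime_entry 4441 14 7 8; prime_entry 4457 5 19 14;
  prime_entry 4481 9 21 6; power_entry 67 2%N [:: 66; 0] [:: 3; 2] [:: 1; 2] [:: 0; 3];
  prime_entry 4513 31 39 5; prime_entry 4561 23 2 13; prime_entry 4649 7 3 6;
  prime_entry 4657 20 21 15; prime_entry 4673 8 3 6; prime_entry 4721 12 17 10;
  prime_entry 4729 34 2 33; prime_entry 4793 8 22 20; prime_entry 4801 35 14 15;
  prime_entry 4817 10 18 6; prime_entry 4889 6 9 3;
  power_entry 17 3%N [:: 16; 0; 14] [:: 1; 1; 1] [:: 2; 0; 0] [:: 0; 1; 1];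
  prime_entry 4937 18 27 3; prime_entry 4969 14 22 8; prime_entry 4993 6 20 17;
  prime_entry 5009 12 15 9; power_entry 71 2%N [:: 70; 0] [:: 3; 3] [:: 1; 5] [:: 3; 2];
  prime_entry 5081 12 19 18; prime_entry 5113 47 21 46; prime_entry 5153 5 10 7;
  prime_entry 5209 30 34 19; prime_entry 5233 26 37 20; prime_entry 5273 20 8 17;
  prime_entry 5281 32 7 14; prime_entry 5297 19 5 15;
  power_entry 73 2%N [:: 68; 0] [:: 2; 2] [:: 3; 2] [:: 0; 1]; prime_entry 5393 14 26 25;
  prime_entry 5417 14 7 8; prime_entry 5441 6 9 3; prime_entry 5449 14 7 8;
  prime_entry 5521 18 22 11; prime_entry 5569 38 15 34; prime_entry 5641 18 7 14;
  prime_entry 5657 5 10 7; prime_entry 5689 14 6 13; prime_entry 5737 20 21 15;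
  prime_entry 5801 14 7 8; prime_entry 5849 22 9 15; prime_entry 5857 14 3 13;
  prime_entry 5881 19 39 6; prime_entry 5897 7 8 6; prime_entry 5953 8 10 5;
  prime_entry 6073 6 20 19; prime_entry 6089 28 18 27; prime_entry 6113 8 3 6;
  prime_entry 6121 14 6 13; prime_entry 6217 12 20 10;
  power_entry 79 2%N [:: 78; 0] [:: 3; 7] [:: 2; 3] [:: 7; 2]; prime_entry 6257 11 5 7;
  prime_entry 6329 6 9 3; prime_entry 6337 20 24 19; prime_entry 6353 11 14 5;
  prime_entry 6361 29 34 13; prime_entry 6449 18 33 15; prime_entry 6473 7 8 6;
  prime_entry 6481 7 33 12; prime_entry 6521 14 21 15; prime_entry 6529 23 33 10;
  prime_entry 6553 23 28 11;
  power_entry 3 8%N [:: 1; 0; 0; 0; 0; 0; 2; 0] [:: 0; 0; 0; 0; 0; 0; 1; 1] [:: 0; 0; 0; 1; 0; 0; 0; 0] [:: 0; 1; 0; 0; 0; 0; 0; 0];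
  prime_entry 6569 19 26 15; prime_entry 6577 12 5 10; prime_entry 6673 11 25 20;
  prime_entry 6689 24 7 21; prime_entry 6737 14 7 8; prime_entry 6761 12 27 9;
  prime_entry 6793 26 38 23; prime_entry 6833 10 15 5; prime_entry 6841 30 33 22;
  prime_entry 6857 27 9 26; power_entry 83 2%N [:: 82; 0] [:: 0; 3] [:: 2; 1] [:: 2; 2];
  prime_entry 6961 14 23 2; prime_entry 6977 7 8 6; prime_entry 7001 13 3 9;
  prime_entry 7057 23 6 20; prime_entry 7121 15 18 3; prime_entry 7129 14 21 15;
  prime_entry 7177 20 2 19; prime_entry 7193 5 10 7; prime_entry 7297 8 10 5;
  prime_entry 7321 8 33 7; prime_entry 7369 2 33 22; prime_entry 7393 21 29 10;
  prime_entry 7417 24 10 20; prime_entry 7433 14 7 8; prime_entry 7457 10 15 5;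
  prime_entry 7481 13 18 3; prime_entry 7489 42 23 39; prime_entry 7529 18 33 6;
  prime_entry 7537 20 8 10; prime_entry 7561 39 3 29; prime_entry 7577 28 9 27;
  prime_entry 7649 13 3 9; prime_entry 7673 11 15 10; prime_entry 7681 18 26 13;
  prime_entry 7753 30 3 13; prime_entry 7793 20 27 18; prime_entry 7817 28 30 27;
  prime_entry 7841 24 7 21; prime_entry 7873 8 10 5;
  power_entry 89 2%N [:: 86; 0] [:: 2; 4] [:: 0; 1] [:: 3; 2]; prime_entry 7937 7 8 6;
  prime_entry 7993 42 13 41; prime_entry 8009 20 27 3; prime_entry 8017 18 10 15;
  prime_entry 8081 36 13 31; prime_entry 8089 38 41 22; prime_entry 8161 24 28 21;
  prime_entry 8209 30 14 29; prime_entry 8233 38 55 30; prime_entry 8273 7 24 15;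
  prime_entry 8297 20 22 6; prime_entry 8329 12 21 7; prime_entry 8353 20 2 17;
  prime_entry 8369 9 21 6; prime_entry 8377 8 10 5; prime_entry 8513 14 5 10;
  prime_entry 8521 23 31 18; prime_entry 8537 12 17 11; prime_entry 8609 22 3 18;
  prime_entry 8641 7 22 8; prime_entry 8681 6 9 3; prime_entry 8689 30 11 22;
  prime_entry 8713 6 30 7; prime_entry 8737 24 10 20; prime_entry 8753 20 9 10;
  prime_entry 8761 38 5 34; prime_entry 8849 7 3 6; prime_entry 8929 23 2 13;
  prime_entry 8969 35 15 21; prime_entry 9001 30 14 29; prime_entry 9041 7 3 6;
  prime_entry 9049 15 7 14; prime_entry 9137 10 14 11; prime_entry 9161 24 2 14;
  prime_entry 9209 18 21 3; prime_entry 9241 30 47 17; prime_entry 9257 12 2 11;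
  prime_entry 9281 12 17 11; prime_entry 9337 22 31 20; prime_entry 9377 19 6 9;
  power_entry 97 2%N [:: 92; 0] [:: 2; 3] [:: 0; 5] [:: 3; 1]; prime_entry 9433 15 25 5;
  prime_entry 9473 20 9 12; prime_entry 9497 12 5 8; prime_entry 9521 34 13 22;
  prime_entry 9601 47 5 46; prime_entry 9649 28 29 12; prime_entry 9689 13 6 12;
  prime_entry 9697 22 23 6; prime_entry 9721 28 17 24; prime_entry 9769 38 51 12;
  prime_entry 9817 17 20 15; prime_entry 9833 7 8 6; prime_entry 9857 5 10 7;
  prime_entry 9929 8 14 12; prime_entry 10009 15 7 14; prime_entry 10169 8 3 6;
  prime_entry 10177 38 10 35; prime_entry 10193 14 6 12;
  power_entry 101 2%N [:: 99; 0] [:: 0; 3] [:: 0; 1] [:: 2; 1]; prime_entry 10273 12 15 5;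
  prime_entry 10289 8 3 6; prime_entry 10313 5 10 7; prime_entry 10321 8 28 14;
  prime_entry 10337 10 17 6; prime_entry 10369 23 30 11; prime_entry 10433 18 5 14;
  prime_entry 10457 15 5 14; prime_entry 10513 23 42 11; prime_entry 10529 6 9 3;
  prime_entry 10601 6 9 3; power_entry 103 2%N [:: 102; 0] [:: 2; 2] [:: 1; 3] [:: 2; 1];
  prime_entry 10657 29 10 25; prime_entry 10729 29 14 28; prime_entry 10753 11 13 8;
  prime_entry 10889 14 21 15; prime_entry 10937 15 27 5; prime_entry 10993 15 3 13;
  prime_entry 11057 18 20 11; prime_entry 11113 46 67 30; prime_entry 11161 14 21 15;
  prime_entry 11177 24 9 23; prime_entry 11257 31 10 30; prime_entry 11273 7 8 6;
  prime_entry 11321 14 3 13; prime_entry 11329 29 10 21; prime_entry 11353 8 10 5;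
  prime_entry 11369 6 9 3; prime_entry 11393 8 3 6;
  power_entry 107 2%N [:: 106; 0] [:: 0; 3] [:: 2; 1] [:: 2; 2]; prime_entry 11489 7 3 6;
  prime_entry 11497 14 6 7; prime_entry 11593 11 25 5; prime_entry 11617 38 52 23;
  prime_entry 11633 10 18 6; prime_entry 11657 11 14 5; prime_entry 11681 6 9 3;
  prime_entry 11689 14 7 8; prime_entry 11777 10 17 6; prime_entry 11801 18 33 24;
  prime_entry 11833 21 2 10; power_entry 109 2%N [:: 107; 0] [:: 0; 3] [:: 0; 2] [:: 2; 2];
  prime_entry 11897 5 10 7; prime_entry 11953 20 8 19; prime_entry 11969 15 3 13;
  prime_entry 12041 23 30 3; prime_entry 12049 39 42 19; prime_entry 12073 37 47 22;
  prime_entry 12097 11 22 14; prime_entry 12113 14 6 9; prime_entry 12161 19 27 12;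
  prime_entry 12241 29 7 20; prime_entry 12281 6 9 3; prime_entry 12289 32 11 22;
  prime_entry 12329 27 3 22; prime_entry 12377 20 22 13; prime_entry 12401 6 9 3;
  prime_entry 12409 42 11 37; prime_entry 12433 14 20 15; prime_entry 12457 46 14 45;
  prime_entry 12473 5 19 14; prime_entry 12497 20 9 19; prime_entry 12553 31 13 24;
  prime_entry 12569 12 20 15; prime_entry 12577 15 26 3; prime_entry 12601 32 11 22;
  prime_entry 12641 22 9 12; prime_entry 12689 6 13 12; prime_entry 12697 15 28 23;
  prime_entry 12713 19 12 18; prime_entry 12721 18 26 13;
  power_entry 113 2%N [:: 110; 0] [:: 0; 5] [:: 1; 2] [:: 0; 4]; prime_entry 12809 6 9 3;
  prime_entry 12841 35 14 24; prime_entry 12889 14 33 22; prime_entry 12953 14 15 13;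
  prime_entry 13001 7 3 6; prime_entry 13009 30 14 28; prime_entry 13033 18 13 15;
  prime_entry 13049 28 15 21; prime_entry 13121 15 3 13; prime_entry 13177 11 14 8;
  prime_entry 13217 19 30 11; prime_entry 13241 7 3 6; prime_entry 13249 14 17 3;
  prime_entry 13297 18 10 15; prime_entry 13313 7 8 6; prime_entry 13337 13 20 3;
  prime_entry 13417 22 27 21; prime_entry 13441 30 34 19; prime_entry 13457 7 8 6;
  prime_entry 13513 25 10 20; prime_entry 13537 15 2 7; prime_entry 13553 23 10 20;
  prime_entry 13577 5 10 7; prime_entry 13633 24 29 5; prime_entry 13649 7 19 14;
  prime_entry 13681 14 2 13; prime_entry 13697 12 2 11; prime_entry 13721 6 9 3;
  prime_entry 13729 35 17 34; prime_entry 13841 9 21 6; prime_entry 13873 15 2 10;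
  prime_entry 13913 6 27 9; prime_entry 13921 7 33 12; prime_entry 14009 13 3 9;
  prime_entry 14033 12 2 11; prime_entry 14057 8 3 6; prime_entry 14081 7 3 6;
  prime_entry 14153 7 8 6; prime_entry 14177 13 2 12; prime_entry 14249 9 21 6;
  prime_entry 14281 39 8 26; prime_entry 14321 22 9 12; prime_entry 14369 30 39 9;
  prime_entry 14401 38 42 31; prime_entry 14449 62 67 29; prime_entry 14489 8 3 6;
  prime_entry 14537 18 7 11; prime_entry 14561 6 9 3; prime_entry 14593 23 35 10;
  prime_entry 14633 10 17 14;
  power_entry 11 4%N [:: 9; 10; 0; 0] [:: 1; 1; 1; 1] [:: 0; 1; 0; 0] [:: 0; 1; 1; 1];
  prime_entry 14657 7 8 6; prime_entry 14713 29 13 28; prime_entry 14737 26 47 37;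
  prime_entry 14753 22 24 9; prime_entry 14897 7 17 6; prime_entry 14929 52 53 22;
  prime_entry 14969 15 18 13; prime_entry 15017 20 6 9; prime_entry 15073 31 17 30;
  prime_entry 15121 23 33 20; prime_entry 15137 11 5 7; prime_entry 15161 12 20 6;
  prime_entry 15193 5 15 12; prime_entry 15217 14 34 31; prime_entry 15233 10 15 5;
  prime_entry 15241 23 35 22; prime_entry 15289 23 37 14; prime_entry 15313 31 14 19;
  prime_entry 15329 6 9 3; prime_entry 15361 58 14 51; prime_entry 15377 20 7 8;
  prime_entry 15401 7 3 6; prime_entry 15473 12 2 11; prime_entry 15497 12 5 8;
  prime_entry 15569 24 10 23; prime_entry 15601 20 21 7;
  power_entry 5 6%N [:: 4; 0; 0; 4; 0; 0] [:: 0; 0; 0; 0; 1; 2] [:: 0; 1; 0; 0; 1; 1] [:: 0; 1; 0; 1; 1; 1];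
  prime_entry 15641 13 3 9; prime_entry 15649 20 41 19; prime_entry 15737 5 10 7;
  prime_entry 15761 9 31 12; prime_entry 15809 55 27 36; prime_entry 15817 12 20 10;
  prime_entry 15881 14 18 13; prime_entry 15889 18 21 14; prime_entry 15913 20 8 19;
  prime_entry 15937 30 2 21; prime_entry 16001 13 3 9; prime_entry 16033 15 2 7;
  prime_entry 16057 8 10 5; prime_entry 16073 10 15 5; prime_entry 16097 8 3 6;
  power_entry 127 2%N [:: 126; 0] [:: 4; 1] [:: 2; 5] [:: 3; 1]; prime_entry 16193 24 14 21;
  prime_entry 16217 7 8 6; prime_entry 16249 47 59 22; prime_entry 16273 24 10 15;
  prime_entry 16361 18 24 15; prime_entry 16369 8 26 7; prime_entry 16417 30 3 29;
  prime_entry 16433 10 18 6; prime_entry 16481 8 24 12; prime_entry 16529 6 9 3;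
  prime_entry 16553 28 30 27; prime_entry 16561 15 7 14; prime_entry 16633 35 10 23;
  prime_entry 16649 10 27 12; prime_entry 16657 30 7 15; prime_entry 16673 22 9 14;
  prime_entry 16729 14 21 15; prime_entry 16889 6 9 3; prime_entry 16921 52 11 26;
  prime_entry 16937 15 3 13; prime_entry 16993 18 20 10; prime_entry 17033 6 20 17;
  prime_entry 17041 22 11 12; prime_entry 17137 30 7 29;
  power_entry 131 2%N [:: 130; 0] [:: 1; 5] [:: 3; 2] [:: 4; 1]; prime_entry 17209 42 49 23;
  prime_entry 17257 24 10 15; prime_entry 17321 12 14 9; prime_entry 17377 6 20 17;
  prime_entry 17393 14 6 9; prime_entry 17401 12 21 7; prime_entry 17417 28 3 27;
  prime_entry 17449 24 14 21; prime_entry 17489 14 7 8; prime_entry 17497 45 50 11;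
  prime_entry 17569 22 11 12; prime_entry 17609 24 10 23; prime_entry 17657 11 14 13;
  prime_entry 17681 14 7 8; prime_entry 17713 20 8 13; prime_entry 17729 18 7 12;
  prime_entry 17737 26 5 22; prime_entry 17761 32 11 22; prime_entry 17881 59 21 58;
  prime_entry 17921 6 9 3; prime_entry 17929 56 57 31; prime_entry 17977 20 23 3;
  prime_entry 18041 15 18 3; prime_entry 18049 34 6 29; prime_entry 18089 6 9 3;
  prime_entry 18097 12 5 10; prime_entry 18121 38 63 44; prime_entry 18169 23 29 3;
  prime_entry 18217 15 2 7; prime_entry 18233 15 5 14; prime_entry 18257 31 45 18;
  prime_entry 18289 14 17 6; prime_entry 18313 20 25 15; prime_entry 18329 26 3 15;
  prime_entry 18353 14 6 9; prime_entry 18401 13 3 9; prime_entry 18433 20 29 7;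
  prime_entry 18457 18 5 10; prime_entry 18481 38 7 26; prime_entry 18521 15 5 11;
  prime_entry 18553 15 2 10; prime_entry 18593 28 3 27; prime_entry 18617 22 6 21;
  prime_entry 18713 18 6 13; power_entry 137 2%N [:: 134; 0] [:: 1; 3] [:: 3; 2] [:: 3; 1];
  prime_entry 18793 14 7 8; prime_entry 18913 14 7 8; prime_entry 19001 6 20 7;
  prime_entry 19009 18 46 23; prime_entry 19073 10 17 5; prime_entry 19081 12 14 7;
  prime_entry 19121 15 18 3; prime_entry 19249 22 6 17; prime_entry 19273 30 13 21;
  prime_entry 19289 24 27 9; power_entry 139 2%N [:: 138; 0] [:: 2; 1] [:: 1; 3] [:: 2; 2];
  prime_entry 19417 26 35 22; prime_entry 19433 6 19 18; prime_entry 19441 35 47 34;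
  prime_entry 19457 23 6 18; prime_entry 19489 32 11 22; prime_entry 19553 8 3 6;
  prime_entry 19577 18 27 20; prime_entry 19609 12 26 13; prime_entry 19681 18 22 11;
  prime_entry 19697 12 17 8; prime_entry 19753 8 10 5; prime_entry 19777 24 11 23;
  prime_entry 19793 13 14 3; prime_entry 19801 8 26 13; prime_entry 19841 15 5 11;
  prime_entry 19889 6 9 3; prime_entry 19913 14 6 9; prime_entry 19937 8 3 6;
  prime_entry 19961 6 9 3; prime_entry 19993 71 39 70; prime_entry 20089 24 14 21;
  prime_entry 20113 31 10 23; prime_entry 20129 6 9 3; prime_entry 20161 39 12 38;
  prime_entry 20177 20 27 26; prime_entry 20201 8 3 6; prime_entry 20233 14 7 8;
  prime_entry 20249 14 19 5; prime_entry 20297 25 5 24; prime_entry 20353 27 10 15;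
  prime_entry 20369 19 23 6; prime_entry 20393 14 6 12; prime_entry 20441 6 9 3;
  prime_entry 20521 23 33 7; prime_entry 20593 6 17 7; prime_entry 20641 47 61 35;
  prime_entry 20681 19 6 12; prime_entry 20753 8 22 3; prime_entry 20809 22 30 7;
  prime_entry 20849 6 9 3; prime_entry 20857 21 23 10; prime_entry 20873 5 19 14;
  prime_entry 20897 26 12 15; prime_entry 20921 22 3 18; prime_entry 20929 12 14 7;
  prime_entry 21001 18 33 11; prime_entry 21017 20 27 9; prime_entry 21089 15 5 11;
  prime_entry 21121 18 57 23; prime_entry 21169 20 26 13; prime_entry 21193 22 33 3;
  prime_entry 21313 26 49 5; prime_entry 21377 7 19 2; prime_entry 21401 7 3 6;
  prime_entry 21433 20 6 15; prime_entry 21481 24 28 21; prime_entry 21521 14 3 10;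
  prime_entry 21529 34 37 6; prime_entry 21569 13 18 3; prime_entry 21577 23 28 11;
  prime_entry 21601 15 34 14; prime_entry 21617 5 10 7; prime_entry 21649 15 35 28;
  prime_entry 21673 23 39 24; prime_entry 21713 14 6 13; prime_entry 21737 25 3 24;
  prime_entry 21817 15 7 12; prime_entry 21841 39 11 33; prime_entry 21881 8 3 6;
  prime_entry 21929 13 3 9; prime_entry 21937 14 18 7; prime_entry 21961 46 52 29;
  prime_entry 21977 21 12 14; prime_entry 22073 5 10 7; prime_entry 22129 34 2 33;
  prime_entry 22153 8 10 5; prime_entry 22193 12 2 11;
  power_entry 149 2%N [:: 147; 0] [:: 0; 1] [:: 3; 0] [:: 0; 2]; prime_entry 22273 6 14 7;
  prime_entry 22369 23 11 22; prime_entry 22409 6 9 3; prime_entry 22433 7 8 6;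
  prime_entry 22441 35 49 14; prime_entry 22481 7 3 6; prime_entry 22697 30 20 29;
  prime_entry 22721 11 18 7; prime_entry 22769 8 3 6; prime_entry 22777 50 5 34;
  power_entry 151 2%N [:: 150; 0] [:: 3; 3] [:: 1; 5] [:: 3; 2]; prime_entry 22817 10 15 5;
  prime_entry 22921 14 7 8; prime_entry 22937 7 8 6; prime_entry 22961 7 3 6;
  prime_entry 22993 8 10 5; prime_entry 23017 31 39 12; prime_entry 23041 39 7 29;
  prime_entry 23057 12 5 11; prime_entry 23081 6 9 3; prime_entry 23201 6 9 3;
  prime_entry 23209 44 12 33; prime_entry 23297 10 15 5; prime_entry 23321 6 9 3;
  prime_entry 23369 18 7 12; prime_entry 23417 6 20 14; prime_entry 23473 20 6 15;
  prime_entry 23497 18 13 15; prime_entry 23537 23 10 14; prime_entry 23561 28 36 27;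
  prime_entry 23593 12 17 7; prime_entry 23609 19 12 15; prime_entry 23633 22 6 17;
  prime_entry 23689 12 33 11; prime_entry 23753 5 10 7; prime_entry 23761 35 7 22;
  prime_entry 23801 22 23 9; prime_entry 23833 5 15 12; prime_entry 23857 38 14 35;
  prime_entry 23873 15 5 14; prime_entry 23929 20 21 7; prime_entry 23977 12 20 17;
  prime_entry 23993 26 5 18; prime_entry 24001 12 21 7; prime_entry 24049 30 34 17;
  prime_entry 24097 14 7 8; prime_entry 24113 12 5 8; prime_entry 24121 14 6 13;
  prime_entry 24137 5 10 7; prime_entry 24169 14 7 8; prime_entry 24281 15 3 13;
  prime_entry 24329 10 27 12; prime_entry 24337 6 14 7; prime_entry 24473 14 6 13;
  prime_entry 24481 32 11 22; prime_entry 24593 10 15 5;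
  power_entry 157 2%N [:: 155; 0] [:: 1; 1] [:: 0; 4] [:: 0; 2]; prime_entry 24697 11 25 5;
  prime_entry 24793 11 14 8; prime_entry 24809 12 15 9; prime_entry 24841 14 35 15;
  prime_entry 24889 32 11 22; prime_entry 24953 12 17 11; prime_entry 24977 6 27 9;
  prime_entry 25033 20 6 15; prime_entry 25057 20 6 15; prime_entry 25073 12 5 8;
  prime_entry 25097 10 15 5; prime_entry 25121 14 18 13; prime_entry 25153 12 15 5;
  prime_entry 25169 28 15 21; prime_entry 25321 23 41 18; prime_entry 25409 14 6 9;
  prime_entry 25457 12 5 11; prime_entry 25537 23 3 10; prime_entry 25561 6 34 17;
  prime_entry 25577 12 2 11].

Local Close Scope N_scope.

(** The 3197 values starting at 25 are the numbers [8 * n + 1] with [2 < n < 3200]. *)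
Lemma frame_table_complete : sweep 3197 25 frame_table.
Proof. by vm_compute. Qed.

Lemma to_nat_pow (a : N) k : N.to_nat (N.pow a (N.of_nat k)) = N.to_nat a ^ k.
Proof.
by elim: k => // k IH; rewrite Nat2N.inj_succ N.pow_succ_r' N2Nat.inj_mul IH expnS.
Qed.

(** A divisor [d > 1] of [p ^ k] is [p ^ j] with [j > 0], so its 16th power is divisible by [p ^ k]
    when [k <= 16]. *)
Lemma not_prime_powerP fuel (d q : N) (p k : nat) :
    prime p -> N.to_nat q = p ^ k -> k <= 16 -> 1 < N.to_nat d ->
  ~~ not_prime_power fuel d q.
Proof.
move=> pp qE k16; elim: fuel d => //= fuel IH d d1.
have q0 : N.to_nat q != 0 by rewrite qE -lt0n expn_gt0 prime_gt0.
have modE (a b : N) : N.to_nat b != 0 ->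
    (N.modulo a b == N0) = (N.to_nat b %| N.to_nat a).
  move=> b0; apply/eqP/dvdnP => [ab|[c ac]].
    exists (N.to_nat (N.div a b)); have := N.div_mod' a b; lia.
  have {ac} -> : a = N.mul (N.of_nat c) b by lia.
  by apply: N.Div0.mod_mul.
have d0 : N.to_nat d != 0 by lia.
rewrite modE //; case: ifP => [|_]; last by apply: IH; lia.
rewrite modE // negbK qE => /(dvdn_pfactor _ _ pp)[j _ dE].
have j0 : 0 < j by case: j dE d1 => // ->.
rewrite -[X in _ %| N.to_nat X]/(N.pow d (N.of_nat 16)) to_nat_pow.
by rewrite dE -expnM dvdn_exp2l // mulnC; lia.
Qed.

(* Otherwise [/=] would unfold all the fuel. *)
Arguments not_prime_power : simpl never.

Lemma sweepP m q ws : sweep m q ws -> forall i, i < m ->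
  not_prime_power 80 3 (q + 8 * N.of_nat i) \/
  exists2 w, entry_card w = (q + 8 * N.of_nat i)%num & check_entry w.
Proof.
have step i : (q + 8 * N.of_nat i.+1 = (q + 8) + 8 * N.of_nat i)%num by lia.
elim: m q ws step => // m IH q ws step swp [_|i i_lt].
  rewrite N.mul_0_r N.add_0_r; move: swp; rewrite /=.
  case: ws => [|w ws]; first by case: ifP => // *; left.
  case: ifP => [/eqP wq|_]; last by case: ifP => // *; left.
  by case: ifP => // chk _; right; exists w.
rewrite step.
have IHi ws' : sweep m (q + 8) ws' -> _ := fun h => IH _ ws' _ h i i_lt.
move: swp; rewrite /=; case: ws => [|w ws].
  by case: ifP => // _ /IHi; apply=> *; lia.
case: ifP => [_|_]; case: ifP => // _ /IHi; apply=> *; lia.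
Qed.

(** The base [p] is hidden inside [w], so its vanishing in [F] is asked of every base having a power
    equal to [#|F|]. *)
Lemma check_entryP (F : finFieldType) n (w : entry) :
    0 < n -> #|F| = 8 * n + 1 -> N.to_nat (entry_card w) = #|F| ->
    (forall m, N.to_nat (N.pow m.1 (N.of_nat m.2)) = #|F| -> ((N.to_nat m.1)%:R = 0 :> F)%R) ->
    check_entry w ->
  exists b1 b2 b3 b4 : F, quartic_frame n b1 b2 b3 b4.
Proof.
move=> n0 cardF; case: w => [[[p k] r] [[b2 b3] b4]] cardw char0.
rewrite /check_entry; case qE : (entry_card _) => [//|q]; case eE : (N.div _ 4) => [//|e].
case/and5P=> p_neq0 k0 le_rk root_chk chk.
have p0 : ((N.to_nat p)%:R = 0 :> F)%R := char0 (p, k) cardw.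
rewrite qE in cardw; have e2n : N.to_nat (Npos e) = 2 * n.
  move: cardw; rewrite cardF -eE; move: (Npos q) => Q QE.
  have m4 : N.lt (N.modulo Q 4) 4 by apply: N.mod_lt.
  by have := N.div_mod' Q 4; move: (N.div Q 4) (N.modulo Q 4) m4 => a b; lia.
have [t tk] : exists t : F, (t ^+ k)%R = veval t r.
  move: root_chk; case: eqP => [-> /eqP-> | _ frob].
    by exists 0%R; rewrite expr0n.
  apply: root_in_field p0 le_rk k0 frob _; first by rewrite -cardw.
  by apply/all_pred1P; rewrite size_nseq.
exists (veval t (vone k)), (veval t b2), (veval t b3), (veval t b4).
exact: check_frameP chk.
Qed.

Lemma small_quartic_frame (F : finFieldType) n p k : prime p -> #|F| = p ^ k ->
    #|F| = 8 * n + 1 -> 2 < n -> n < 3200 ->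
  exists b1 b2 b3 b4 : F, quartic_frame n b1 b2 b3 b4.
Proof.
move=> pp cardFp cardF n_gt n_lt; have n0 : 0 < n by lia.
have k0 : 0 < k by case: (k) cardFp => //; rewrite cardF; lia.
have qE : N.to_nat (25 + 8 * N.of_nat (n - 3)) = #|F| by rewrite cardF; lia.
have i_lt : n - 3 < 3197 by lia.
have [npp|[w wE chk]] := sweepP frame_table_complete i_lt.
  (* Here [2 ^ k <= p ^ k = #|F| < 2 ^ 16]. *)
  have k16 : k <= 16.
    rewrite -(leq_exp2l _ _ (isT : 1 < 2)) (@leq_trans (p ^ k)) //.
      by rewrite leq_exp2r // prime_gt1.
    by rewrite -cardFp cardF; lia.
  by rewrite cardFp in qE; case/negP: (not_prime_powerP 80 pp qE k16 (isT : 1 < N.to_nat 3)).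
apply: (check_entryP n0 cardF _ _ chk); first by rewrite wE.
move=> [m j] /=; rewrite to_nat_pow cardFp => mj.
have pF := card_finPcharP cardFp pp.
have : p %| N.to_nat m ^ j by rewrite mj -[X in X %| _]expn1 dvdn_exp2l.
rewrite Euclid_dvdX // => /andP[/dvdnP[c ->] _].
by rewrite natrM (pcharf0 pF) mulr0.
Qed.

(** * The field of order 17 *)

(** The quadruple is 1, 3, 7 on level 0 and -7 on level 1. Since it already contains both 7 and -7,
    the pairs [2, -1] and [-2, -3] complete the elements to the four classes of 1, 3, 7, 2, each
    with both signs. *)
Lemma class_card17 (F : finFieldType) : #|F| = 17 ->
  exists P : {set {set ('Z_2 * F)%type}},
    is_PDF (nseq (4 * 2 + 1) 2 ++ nseq (2 * 2) 4) 2 P /\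
    is_base_parallel_class (pred2 2 4) (2 * #|F|) P.
Proof.
move=> card17; have cardF : #|F| = 8 * 2 + 1 by rewrite card17.
have p0 : ((N.to_nat 17)%:R = 0 :> F)%R.
  exact: pcharf0 (card_finPcharP (n := 1) card17 (isT : prime 17)).
have p_neq0 : 17%num != N0 by [].
have tk : (0 ^+ 1 = veval 0 [::] :> F)%R by rewrite expr1.
pose neg := vneg 17 1; pose sub := vsub 17.
pose y1 := [:: 1%num]; pose y2 := [:: 2%num]; pose y3 := [:: 3%num]; pose y7 := [:: 7%num].
pose ys := [:: y1; y3; y7; y2; sub y1 y3; sub y1 y7; sub y3 y7; sub y2 (neg y1);
  sub y1 (neg y7); sub y3 (neg y7); sub y7 (neg y7); sub (neg y2) (neg y3)].
pose T4 := nseq 4 true; pose F4 := nseq 4 false.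
have [|nz u] := check_powersP (xs := ys) (masks := [:: T4; F4 ++ T4; F4 ++ F4 ++ T4])
  (isT : 0 < 2) cardF p_neq0 p0 tk (erefl : Pos.to_nat 4 = 2 * 2).
  by vm_compute.
have negE l : (veval 0 (neg l) = - veval 0 l :> F)%R.
  by rewrite veval_sub // veval_nseq0 sub0r.
have subE l l' : (veval 0 (sub l l') = veval 0 l - veval 0 l' :> F)%R.
  by rewrite veval_sub.
(* From here on only the field values of the lists matter; making the names opaque keeps
   simplification from computing with the lists. *)
clearbody neg sub y1 y2 y3 y7.
have := u (F4 ++ F4 ++ T4) isT; have := u (F4 ++ T4) isT; have := u T4 isT.
move: nz => {u}; rewrite /ys [mask T4 _]/= [mask (F4 ++ T4) _]/= [mask (F4 ++ _ ++ T4) _]/=.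
rewrite !map_cons !(subE, negE) !opprK.
move: (veval _ y1) (veval _ y2) (veval _ y3) (veval _ y7) => x1 x2 x3 x7.
rewrite !inE !negb_or ![(0 == _)%R]eq_sym => /and5P[n1 n3 n7 n2 /and5P[n4 n5 n6 n8]].
case/and4P=> m1 m2 m3 m4 u1 u2 u3.
have z1 : all (predC1 0%R) [:: x1; x3; x7; x2] by rewrite /= n1 n3 n7 n2.
have z2 : all (predC1 0%R) [:: x1 - x3; x1 - x7; x3 - x7; x2 + x1]%R.
  by rewrite /= n4 n5 n6 n8.
have z3 : all (predC1 0%R) [:: x1 + x7; x3 + x7; x7 + x7; - x2 + x3]%R.
  by rewrite /= m1 m2 m3 m4.
pose B : seq ('Z_2 * F) := [:: (0, x1); (0, x3); (0, x7); (1, - x7)]%R.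
pose D1 : seq ('Z_2 * F) := [:: (0, x2); (0, - x1)]%R.
pose D2 : seq ('Z_2 * F) := [:: (0, - x2); (1, - x3)]%R.
apply: (@quartic_family F 2 B D1 D2) => // [x x0|x e x0].
  have [y ys_y ->] := unity4_surj (isT : 0 < 2) cardF z1 (erefl 4) u1 x0.
  move: ys_y; rewrite !inE => /or4P[] /eqP->.
  - by exists (0, x1)%R, (0, - x1)%R; rewrite !inE !eqxx ?orbT.
  - by exists (0, x3)%R, (1, - x3)%R; rewrite !inE !eqxx ?orbT.
  - by exists (0, x7)%R, (1, - x7)%R; rewrite !inE !eqxx ?orbT.
  - by exists (0, x2)%R, (0, - x2)%R; rewrite !inE !eqxx ?orbT.
have := Z2P e; rewrite !inE => /orP[]/eqP->.
  have [y ys_y ->] := unity4_surj (isT : 0 < 2) cardF z2 (erefl 4) u2 x0.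
  move: ys_y; rewrite !inE => /or4P[] /eqP->.
  - by exists B, (0, x1)%R, (0, x3)%R; rewrite !inE !eqxx ?orbT subrr.
  - by exists B, (0, x1)%R, (0, x7)%R; rewrite !inE !eqxx ?orbT subrr.
  - by exists B, (0, x3)%R, (0, x7)%R; rewrite !inE !eqxx ?orbT subrr.
  - by exists D1, (0, x2)%R, (0, - x1)%R; rewrite !inE !eqxx ?orbT subrr /= opprK.
have N1 : (0 - 1 = 1 :> 'Z_2)%R by apply: val_inj.
have [y ys_y ->] := unity4_surj (isT : 0 < 2) cardF z3 (erefl 4) u3 x0.
move: ys_y; rewrite !inE => /or4P[] /eqP->.
- by exists B, (0, x1)%R, (1, - x7)%R; rewrite !inE !eqxx ?orbT N1 /= opprK.
- by exists B, (0, x3)%R, (1, - x7)%R; rewrite !inE !eqxx ?orbT N1 /= opprK.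
- by exists B, (0, x7)%R, (1, - x7)%R; rewrite !inE !eqxx ?orbT N1 /= opprK.
- by exists D2, (0, - x2)%R, (1, - x3)%R; rewrite !inE !eqxx ?orbT N1 /= opprK.
Qed.

Theorem theorem6p1 (p k q n : nat) (F : finFieldType)
    (p_prime : prime p) (k_gt0 : 0 < k) (qE : q = p ^ k)
    (q8n1 : q = 8 * n + 1) (q_gt9 : 9 < q) (cardF : #|F| = q) :
  exists P : {set {set ('Z_2 * F)%type}},
    is_PDF (nseq (4 * n + 1) 2 ++ nseq (2 * n) 4) 2 P /\
    is_base_parallel_class (pred2 2 4) (2 * q) P.
Proof.
have n_gt1 : 1 < n by lia.
have cardFn : #|F| = 8 * n + 1 by rewrite cardF.
rewrite -cardF; have [n2|n_neq2] := eqVneq n 2.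
  by rewrite n2; apply: class_card17; rewrite cardFn n2.
have [b1 [b2 [b3 [b4 frame]]]] : exists b1 b2 b3 b4 : F, quartic_frame n b1 b2 b3 b4.
  have [n_large|n_small] := leqP 3200 n; first exact: exists_quartic_frame.
  by apply: (small_quartic_frame p_prime _ cardFn) => //; [rewrite cardF qE|lia].
by apply: quartic_frame_class frame; lia.
Qed.
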